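(* Suppose that $\mathbb{E}(Y^2)<+\infty$, $\mathbb{E}(\|\mathbf X\|^2)<+\infty$ and $\operatorname{rank}(\boldsymbol\mu_{1,X})=d+1$. Then the sequence of estimators $(\widehat{\boldsymbol\beta}^M,\widehat\sigma_\epsilon^{2,M})$ converges in probability to $(\boldsymbol\beta,\sigma_\epsilon^2)$ when $n_{\min}$ tends to infinity.
   Context: Setting. $Y$ is a real random variable, $\mathbf X=(X_1,\dots,X_d)$ a random vector in $\mathbb{R}^d$, $G$ a categorical variable with values in $\{1,\dots,K\}$ and $\mathbb{P}[G=k]>0$ for all $k$, and the linear model $Y=\beta_0+\sum_{j=1}^d\beta_jX_j+\epsilon$ holds, where $\epsilon$ is independent of $(\mathbf X,G)$, has mean zero and variance $\sigma_\epsilon^2$, and $\boldsymbol\beta=(\beta_0,\dots,\beta_d)^\top$. Put $\boldsymbol\mu_X^k=\mathbb{E}(\mathbf X\mid G=k)\in\mathbb{R}^d$, and let $\boldsymbol\mu_{1,X}$ be the $K\times(d+1)$ matrix with $k$th row $(1,\boldsymbol\mu_X^{k\top})$. Data. $\mathbf X$ and $Y$ are never observed jointly. $K$ is fixed. For each $k$ there are an i.i.d. sample $Y_1^k,\dots,Y_{n_y^k}^k$ from the conditional law of $Y$ given $G=k$ and an i.i.d. sample $\mathbf X_1^k,\dots,\mathbf X_{n_x^k}^k$ from the conditional law of $\mathbf X$ given $G=k$; these $2K$ samples are mutually independent. $N_y=\sum_kn_y^k$, $N_x=\sum_kn_x^k$, $n_{\min}=\min(n_y^1,\dots,n_y^K,n_x^1,\dots,n_x^K)$.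 Estimators. $\widehat\mu_Y^k=\frac1{n_y^k}\sum_iY_i^k$, $\widehat{\boldsymbol\mu}_X^k=\frac1{n_x^k}\sum_i\mathbf X_i^k$, $\widehat{\boldsymbol\mu}_Y=(\widehat\mu_Y^1,\dots,\widehat\mu_Y^K)^\top$, $\widehat{\boldsymbol\mu}_{1,X}$ is the $K\times(d+1)$ matrix with $k$th row $(1,\widehat{\boldsymbol\mu}_X^{k\top})$. Total empirical moments: $\widehat\mu_Y=\frac1{N_y}\sum_kn_y^k\widehat\mu_Y^k$, $\widehat{\boldsymbol\mu}_X=\frac1{N_x}\sum_kn_x^k\widehat{\boldsymbol\mu}_X^k$, $\widehat\sigma_Y^2=\frac1{N_y}\sum_k\sum_i(Y_i^k)^2-\widehat\mu_Y^2$, $\widehat{\boldsymbol\Gamma}_X=\frac1{N_x}\sum_k\sum_i\mathbf X_i^k(\mathbf X_i^k)^\top-\widehat{\boldsymbol\mu}_X\widehat{\boldsymbol\mu}_X^\top$. With $\mathbf w=\mathrm{diag}(w_1,\dots,w_K)$ for fixed weights $w_k>0$, $\sum_kw_k=1$, $$\widehat{\boldsymbol\beta}^M=\left(\widehat{\boldsymbol\mu}_{1,X}^\top\mathbf w\widehat{\boldsymbol\mu}_{1,X}\right)^{-1}\widehat{\boldsymbol\mu}_{1,X}^\top\mathbf w\widehat{\boldsymbol\mu}_Y,\qquad \widehat\sigma_\epsilon^{2,M}=\widehat\sigma_Y^2-(\widehat{\boldsymbol\beta}_{-0}^M)^\top\widehat{\boldsymbol\Gamma}_X\widehat{\boldsymbol\beta}_{-0}^M,$$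 when $\widehat{\boldsymbol\mu}_{1,X}$ has full rank $d+1$ (defined arbitrarily otherwise), where $\widehat{\boldsymbol\beta}_{-0}^M$ is $\widehat{\boldsymbol\beta}^M$ without its first (intercept) component.
   Formalization: The convergence of the variance estimator (and so of the pair) is proved when n_y^k/N_y − n_x^k/N_x → 0 for every k; without such a condition it can fail. The convergence of the estimator of β is proved with no added condition. *)

(* Defs.v *)
From HB Require Import structures.
From mathcomp Require Export all_boot all_order all_algebra.
From mathcomp Require Export all_classical all_reals all_analysis.
Export Order.TTheory GRing.Theory Num.Theory numFieldNormedType.Exports.

Set Implicit Arguments.
Unset Strict Implicit.
Unset Printing Implicit Defensive.

Local Open Scope classical_set_scope.
Local Open Scope ring_scope.

(** Random vectors of R^d are random variables in [d.-tuple R], whose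
    sigma-algebra is generated by the coordinates; linear algebra is done on
    the corresponding column vectors. *)
Definition col_of_tuple (R : Type) (d : nat) (x : d.-tuple R) : 'cV[R]_d :=
  \col_j tnth x j.

Definition enorm (R : realType) (n : nat) (v : 'cV[R]_n) : R :=
  Num.sqrt (\sum_i v i 0 ^+ 2).

Section Probability.
Context {R : realType} {d : measure_display} {T : measurableType d}.
Variable P : probability T R.

Definition cond_prob (A B : set T) : R := fine (P (A `&` B)) / fine (P B).

Definition cond_exp (Z : T -> R) (B : set T) : R :=
  (\int[P]_(t in B) Z t) / fine (P B).

Definition sigma_of d' (T' : measurableType d') (Z : T -> T') : set (set T) :=
  preimage_set_system setT Z measurable.

Definition sigma_join (I : Type) (F : I -> set (set T)) : set (set T) :=
  <<s \bigcup_i F i >>.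

Definition mutually_independent (I : finType) (F : I -> set (set T)) : Prop :=
  forall (J : {set I}) (A : I -> set T), (forall i, i \in J -> F i (A i)) ->
    fine (P (\bigcap_(i in [set` J]) A i)) = \prod_(i in J) fine (P (A i)).

Definition independent2 (F1 F2 : set (set T)) : Prop :=
  forall A B, F1 A -> F2 B -> P (A `&` B) = (P A * P B)%E.

Definition cvg_in_probability (n : nat) (Z : nat -> T -> 'cV[R]_n)
    (z : 'cV[R]_n) : Prop :=
  forall e : R, 0 < e ->
    (fun m => P [set t | e < enorm (Z m t - z)]) @ \oo --> 0%E.

End Probability.

(** [G] takes values in the discrete space ['I_K]. *)
Definition sigma_discrete d (T : measurableType d) (K : nat) (G : T -> 'I_K) :
  set (set T) := preimage_set_system setT G discrete_measurable.

(** [S] is an i.i.d. sample, defined on [(T, P)], of the conditional law of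
    [Z] given [G = k], where [Z] and [G] are defined on [(T0, P0)]. *)
Definition cond_iid_sample (R : realType)
    (d0 : measure_display) (T0 : measurableType d0) (P0 : probability T0 R)
    (d : measure_display) (T : measurableType d) (P : probability T R)
    (d' : measure_display) (T' : measurableType d')
    (Z : T0 -> T') (K : nat) (G : T0 -> 'I_K) (k : 'I_K)
    (n : nat) (S : 'I_n -> T -> T') : Prop :=
  (forall i (B : set T'), measurable B ->
     fine (P (S i @^-1` B)) = cond_prob P0 (Z @^-1` B) (G @^-1` [set k]))
  /\ mutually_independent P (fun i => sigma_of (S i)).

(** The population matrix [mu_{1,X}] and its empirical version are both of the
    form [design mu], with [k]th row [(1, mu_k^T)]. *)
Definition design (R : realType) (K d : nat) (mu : 'I_K -> 'cV[R]_d) :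
  'M[R]_(K, 1 + d) := row_mx (const_mx 1) (\matrix_(k, j) mu k j 0).

Definition total (K : nat) (n : 'I_K -> nat) : nat := (\sum_k n k)%N.

(** The default value [total ny] is at least each [ny k], so it does not affect
    the minimum. *)
Definition nmin (K : nat) (ny nx : 'I_K -> nat) : nat :=
  \big[minn/total ny]_k minn (ny k) (nx k).

Section Estimators.
Unset Implicit Arguments.
Context {R : realType} {K d : nat} {ny nx : 'I_K -> nat}.
Variables (w : 'I_K -> R).
Variables (y : forall k, 'I_(ny k) -> R) (x : forall k, 'I_(nx k) -> 'cV[R]_d).

Definition muY_hat : 'cV[R]_K := \col_k ((ny k)%:R^-1 * \sum_i y k i).

Definition muX_hat (k : 'I_K) : 'cV[R]_d := (nx k)%:R^-1 *: \sum_i x k i.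

Definition muY_tot : R := (total ny)%:R^-1 * \sum_k (ny k)%:R * muY_hat k 0.

Definition muX_tot : 'cV[R]_d :=
  (total nx)%:R^-1 *: \sum_k (nx k)%:R *: muX_hat k.

Definition sigma2Y_hat : R :=
  (total ny)%:R^-1 * (\sum_k \sum_i y k i ^+ 2) - muY_tot ^+ 2.

Definition GammaX_hat : 'M[R]_d :=
  (total nx)%:R^-1 *: (\sum_k \sum_i x k i *m (x k i)^T)
  - muX_tot *m muX_tot^T.

(** [b] and [s] are the arbitrary values of the estimators when the empirical
    design matrix does not have full rank. *)
Definition beta_M (b : 'cV[R]_(1 + d)) : 'cV[R]_(1 + d) :=
  let D := design muX_hat in
  let W := diag_mx (\row_k w k) in
  if \rank D == d.+1 then invmx (D^T *m W *m D) *m D^T *m W *m muY_hat else b.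

Definition sigma2_M (b : 'cV[R]_(1 + d)) (s : R) : R :=
  let b0 := dsubmx (beta_M b) in
  if \rank (design muX_hat) == d.+1
  then sigma2Y_hat - (b0^T *m GammaX_hat *m b0) 0 0 else s.

End Estimators.

(* Main.v *)
From HB Require Import structures.
Require Import Defs.
From mathcomp Require Import ring lra measurable_realfun.

Set Implicit Arguments.
Unset Strict Implicit.
Unset Printing Implicit Defensive.

Local Open Scope classical_set_scope.
Local Open Scope ring_scope.

(** A sequence of events of probability tending to 1 is a member of a filter on
    pairs (index, outcome); convergence in probability is convergence along that
    filter, so sums, products and inverses of estimators are handled by the
    calculus of limits.  Group by group, the weak law of large numbers (for L1
    variables, by truncation and a second moment bound) gives the limits of the
    empirical moments.  The linear model yields [mu_Y = mu_{1,X} beta] and, as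
    [mu_{1,X}] has full column rank, [mu_{1,X}^T w mu_{1,X}] is invertible, so
    the estimator of [beta] converges.  For the variance,
    [E(Y^2 | G = k)] is [sigma2] plus the conditional second moment of the
    regression function, and the two mixtures over the groups have
    asymptotically equal weights, so [sigma2] is all that is left of the
    difference of the variances of [Y] and of [beta^T X]. *)

(** * Convergence in probability as convergence along a filter *)

Section HighProbability.
Context {R : realType} {d : measure_display} {T : measurableType d}.
Variable P : probability T R.

(** The exceptional events are measurable supersets: an event of the family need
    not be measurable itself. *)
Definition high_prob : set_system (nat * T) := [set E |
  exists2 A : nat -> set T, (forall m, measurable (A m)) /\
    (fun m => P (A m)) @ \oo --> 0%E & forall m t, ~ A m t -> E (m, t)].

(** For an intersection, the exceptional events are unions, of probability at most the sum of two
    sequences that tend to 0. *)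
Global Instance high_prob_filter : Filter high_prob.
Proof.
split.
- by exists (fun=> set0) => //; split=> // ; rewrite measure0; exact: cvg_cst.
- move=> E1 E2 [A1 [mA1 A1_0] sA1] [A2 [mA2 A2_0] sA2].
  exists (fun m => A1 m `|` A2 m) => [|m t /not_orP[nA1 nA2]]; last first.
    by split; [exact: sA1|exact: sA2].
  split=> [m|]; first exact: measurableU.
  apply: (@squeeze_cvge _ _ _ _ (cst 0%E) _ (fun m => P (A1 m) + P (A2 m))%E).
  + apply: nearW => m; rewrite measure_ge0/=.
    exact: (measureU2 P).
  + exact: cvg_cst.
  + by rewrite -[X in _ --> X]adde0; apply: cvgeD.
- move=> E1 E2 E12 [A hA sA]; exists A => // m t /sA; exact: E12.
Qed.

(** Carries eventual statements about the index alone over to the filter: the exceptional event is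
    the whole space for finitely many indices and empty afterwards. *)
Lemma cvg_fst_high_prob : (fst : nat * T -> nat) @ high_prob --> \oo.
Proof.
move=> E [N _ NE]; exists (fun m => if (m < N)%N then setT else set0).
  split=> [m|]; first by case: ifP.
  apply: cvg_near_cst; exists N => // m /= Nm.
  by rewrite ltnNge Nm /= measure0.
move=> m t; case: ltnP => [mN|Nm _]; first by case.
exact: (NE m).
Qed.

(** Measurability is bundled in because the way back from the filter to probabilities compares
    measurable deviation events. *)
Definition pcvg (Z : nat -> T -> R) (z : R) : Prop :=
  (forall m, measurable_fun [set: T] (Z m)) /\
  Z q.1 q.2 @[q --> high_prob] --> z.

Lemma pcvgP (Z : nat -> T -> R) (z : R) :
  (forall m, measurable_fun [set: T] (Z m)) ->
  (forall e : R, 0 < e ->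
    P [set t | e < `|Z m t - z|] @[m --> \oo] --> 0%E) ->
  pcvg Z z.
Proof.
move=> mZ Zz; split=> //; apply/cvgrPdist_le => e e0.
exists (fun m => [set t | e < `|Z m t - z|]) => [|m t /=]; last first.
  by move/negP; rewrite -leNgt distrC.
split=> [m|]; last exact: Zz.
have : measurable_fun [set: T] (fun t => e < `|Z m t - z|).
  apply: measurable_fun_ltr => //.
  by apply: measurableT_comp => //; apply: measurable_funB.
by move=> /(_ measurableT [set true] I); rewrite setTI.
Qed.

(** The Euclidean norm is continuous in the entries, so the distance to the limit tends to 0 along
    the filter; each deviation event then lies in an exceptional event of vanishing probability. *)
Lemma pcvg_in_probability n (Z : nat -> T -> 'cV[R]_n) (z : 'cV[R]_n) :
  (forall i, pcvg (fun m t => Z m t i 0) (z i 0)) -> cvg_in_probability P Z z.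
Proof.
move=> Zz e e0.
have en_cvg : enorm (Z q.1 q.2 - z) @[q --> high_prob] --> 0.
  have -> : 0 = Num.sqrt (\sum_(i < n) (z i 0 - z i 0) ^+ 2) :> R.
    by rewrite big1 ?sqrtr0// => i _; rewrite subrr expr0n.
  apply: continuous_cvg; first exact: sqrt_continuous.
  apply: cvg_big => [|i _]; [exact: add_continuous|].
  apply: (@continuous_cvg _ R^o R^o _ _ _ (fun x : R => x ^+ 2)).
    exact: exprn_continuous.
  under eq_cvg do rewrite !mxE.
  by apply: cvgB; [exact: (Zz i).2|exact: cvg_cst].
have [A [mA A0] sA] := (cvgrPdist_le _ _).1 en_cvg e e0.
apply: (squeeze_cvge _ (cvg_cst 0%E) A0); apply: nearW => m.
rewrite measure_ge0/=; apply: le_measure; rewrite ?inE//.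
  have : measurable_fun [set: T] (fun t => e < enorm (Z m t - z)).
    apply: measurable_fun_ltr => //.
    apply: (measurableT_comp (f := @Num.sqrt R)).
      by apply: continuous_measurable_fun; exact: sqrt_continuous.
    apply: measurable_sum => i; apply: measurable_funX.
    under eq_fun do rewrite !mxE.
    by apply: measurable_funB => //; exact: (Zz i).1.
  by move=> /(_ measurableT [set true] I); rewrite setTI.
move=> t /= et; apply: contrapT => /(sA m t) /=.
by rewrite sub0r normrN ger0_norm ?sqrtr_ge0// leNgt et.
Qed.

Lemma pcvg_seq (u : nat -> R) (l : R) : u @ \oo --> l -> pcvg (fun m _ => u m) l.
Proof.
by move=> ul; split=> [//|]; apply: cvg_comp ul; exact: cvg_fst_high_prob.
Qed.

Lemma pcvg_cst (c : R) : pcvg (fun _ _ => c) c.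
Proof. by apply: pcvg_seq; exact: cvg_cst. Qed.

Lemma pcvgD Z1 Z2 z1 z2 : pcvg Z1 z1 -> pcvg Z2 z2 ->
  pcvg (fun m t => Z1 m t + Z2 m t) (z1 + z2).
Proof.
move=> [m1 c1] [m2 c2]; split=> [m|]; first exact: measurable_funD.
exact: cvgD.
Qed.

Lemma pcvgM Z1 Z2 z1 z2 : pcvg Z1 z1 -> pcvg Z2 z2 ->
  pcvg (fun m t => Z1 m t * Z2 m t) (z1 * z2).
Proof.
move=> [m1 c1] [m2 c2]; split=> [m|]; first exact: measurable_funM.
exact: cvgM.
Qed.

Lemma pcvgB Z1 Z2 z1 z2 : pcvg Z1 z1 -> pcvg Z2 z2 ->
  pcvg (fun m t => Z1 m t - Z2 m t) (z1 - z2).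
Proof.
move=> [m1 c1] [m2 c2]; split=> [m|]; first exact: measurable_funB.
exact: cvgB.
Qed.

Lemma pcvg_sum (I : eqType) (r : seq I) (Z : I -> nat -> T -> R)
  (z : I -> R) : (forall i, pcvg (Z i) (z i)) ->
  pcvg (fun m t => \sum_(i <- r) Z i m t) (\sum_(i <- r) z i).
Proof.
move=> Zz; split=> [m|]; first by apply: measurable_sum => i; exact: (Zz i).1.
apply: cvg_big => [|i _]; [exact: add_continuous|].
exact: (Zz i).2.
Qed.

Lemma pcvg_prod (I : eqType) (r : seq I) (Z : I -> nat -> T -> R)
  (z : I -> R) : (forall i, pcvg (Z i) (z i)) ->
  pcvg (fun m t => \prod_(i <- r) Z i m t) (\prod_(i <- r) z i).
Proof.
move=> Zz; split=> [m|].
  by apply: measurable_prod => i _; exact: (Zz i).1.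
apply: cvg_big => [|i _]; [exact: mul_continuous|].
exact: (Zz i).2.
Qed.

Lemma measurable_invr : measurable_fun [set: R] (@GRing.inv R).
Proof.
(* The inverse is discontinuous at 0; this product of measurable maps agrees with it there too, both
   sides being 0. *)
have -> : @GRing.inv R = fun x => x * ((x ^+ 2) `^ (-1)).
  apply/funext => x; rewrite powR_inv1 ?sqr_ge0//.
  have [->|x0] := eqVneq x 0; first by rewrite invr0 mul0r.
  by rewrite expr2 invfM mulrA mulfV// mul1r.
apply: measurable_funM => //.
apply: (measurableT_comp (f := @powR R ^~ (-1)) (g := fun x : R => x ^+ 2)).
  exact: measurable_powR.
exact: measurable_funX.
Qed.

Lemma pcvgV Z z : z != 0 -> pcvg Z z -> pcvg (fun m t => (Z m t)^-1) z^-1.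
Proof.
move=> z0 [mZ cZ]; split=> [m|]; last exact: cvgV.
exact: (measurableT_comp measurable_invr).
Qed.

(** The branch [Z'] is taken on exceptional events only. This absorbs the arbitrary values of the
    estimators under rank deficiency. *)
Lemma pcvg_if (B : nat -> T -> bool) Z Z' z :
  (forall m, measurable_fun [set: T] (B m)) ->
  (\forall q \near high_prob, B q.1 q.2) ->
  (forall m, measurable_fun [set: T] (Z' m)) -> pcvg Z z ->
  pcvg (fun m t => if B m t then Z m t else Z' m t) z.
Proof.
move=> mB B1 mZ' [mZ cZ]; split=> [m|]; first exact: measurable_fun_ifT.
apply: cvg_trans cZ; apply: near_eq_cvg; apply: filterS B1 => q ->.
by [].
Qed.

(** The factor [u] may oscillate: sample proportions are bounded but may fail to converge. *)
Lemma pcvg_bounded0 (u : nat -> R) (M : R) Z : (forall m, `|u m| <= M) ->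
  pcvg Z 0 -> pcvg (fun m t => u m * Z m t) 0.
Proof.
move=> uM [mZ cZ]; split=> [m|]; first exact: measurable_funM.
have M0 : 0 <= M by exact: le_trans (uM 0%N).
apply/norm_cvg0P.
apply: (@squeeze_cvgr _ _ _ _ (cst 0) (fun q => M * `|Z q.1 q.2|)).
- by apply: nearW => q; rewrite normr_ge0 normrM ler_wpM2r.
- exact: cvg_cst.
- rewrite -[X in _ --> X](mulr0 M); apply: cvgMr; exact/norm_cvg0P.
Qed.

End HighProbability.

(** * Laws of random variables and products of independent variables *)

Lemma integrable_distribution {R : realType} d d' (T : measurableType d)
  (T' : measurableType d') (P : probability T R) (X : {RV P >-> T'})
  (f : T' -> \bar R) : measurable_fun [set: T'] f ->
  P.-integrable [set: T] (f \o X) ->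
  (distribution P X).-integrable [set: T'] f.
Proof.
move=> mf /integrableP[_ ifX]; apply/integrableP; split=> //.
by rewrite ge0_integral_distribution//; exact: measurableT_comp.
Qed.

Section IndependentProduct.
Context {R : realType} {d : measure_display} {T : measurableType d}.
Variable P : probability T R.
Local Notation integrable f := (P.-integrable [set: T] (EFin \o f)).

Section Joint.
Variables U V : T -> R.
Hypotheses (mU : measurable_fun [set: T] U) (mV : measurable_fun [set: T] V).
Hypothesis UV : forall A B : set R, measurable A -> measurable B ->
  P (U @^-1` A `&` V @^-1` B) = (P (U @^-1` A) * P (V @^-1` B))%E.

HB.instance Definition _ := isMeasurableFun.Build _ _ _ _ U mU.
HB.instance Definition _ := isMeasurableFun.Build _ _ _ _ V mV.

Let W (t : T) : R * R := (U t, V t).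
Let mW : measurable_fun [set: T] W.
Proof. exact: measurable_fun_pair. Qed.
HB.instance Definition _ := isMeasurableFun.Build _ _ _ _ W mW.

(** Independence is agreement of the two measures on rectangles, and these determine a product
    measure. *)
Let joint_law (A : set (R * R)) : measurable A ->
  (distribution P U \x distribution P V)%E A = distribution P W A.
Proof. by apply: product_measure_unique => A1 A2 mA1 mA2; exact: UV. Qed.

Let mprod : measurable_fun [set: R * R] (fun z : R * R => (z.1 * z.2)%:E).
Proof.
apply/measurable_EFinP; apply: measurable_funM.
  exact: measurable_fst.
exact: measurable_snd.
Qed.

Hypotheses (iU : integrable U) (iV : integrable V).

Let iUd : (distribution P U).-integrable [set: R] (EFin \o id).
Proof. by apply: integrable_distribution => //; exact/measurable_EFinP. Qed.

Let iVd : (distribution P V).-integrable [set: R] (EFin \o id).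
Proof. by apply: integrable_distribution => //; exact/measurable_EFinP. Qed.

(** By Tonelli the integral of the absolute value factors into the two first absolute moments, both
    finite. *)
Let iprod : (distribution P U \x distribution P V)%E.-integrable [set: R * R]
  (fun z : R * R => (z.1 * z.2)%:E).
Proof.
apply/integrable12ltyP => //.
under eq_integral => x _.
  under eq_integral => y _ do rewrite /= normrM EFinM.
  rewrite ge0_integralZl//; last first.
    by apply/measurable_EFinP; exact: normr_measurable.
  over.
rewrite /= ge0_integralZr//=.
- apply: lte_mul_pinfty.
  + exact: integral_ge0.
  + rewrite fin_num_abs gee0_abs ?integral_ge0//.
    by case/integrableP : iUd.
  + by case/integrableP : iVd.
- by apply/measurable_EFinP; exact: normr_measurable.
- exact: integral_ge0.
Qed.

Lemma integrable_indepM : integrable (fun t => U t * V t).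
Proof.
apply/integrableP; split.
  by apply/measurable_EFinP; exact: measurable_funM.
case/integrableP : iprod => _.
rewrite (eq_measure_integral (distribution P W)); last first.
  by move=> A mA _; exact: joint_law.
rewrite ge0_integral_distribution//.
exact: measurableT_comp.
Qed.

(** Fubini under the product law, which is the joint law: the inner integral is a multiple of the
    mean of [V], and the outer one then yields the mean of [U]. *)
Lemma Rintegral_indepM :
  \int[P]_t (U t * V t) = (\int[P]_t U t) * (\int[P]_t V t).
Proof.
rewrite /Rintegral -fineM ?integrable_fin_num//; congr fine.
have := integral12_prod_meas1 iprod.
rewrite (eq_measure_integral (distribution P W)); last first.
  by move=> A mA _; exact: joint_law.
have -> : (\int[distribution P W]_x (x.1 * x.2)%:E =
    \int[P]_x (U x * V x)%:E)%E.
  by apply: integral_distribution; [exact: mprod|exact: integrable_indepM].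
move=> <-; rewrite /fubini_F.
transitivity (\int[distribution P U]_x
    (x%:E * \int[distribution P V]_y y%:E))%E.
  apply: eq_integral => x _; rewrite -(integralZl _ iVd)//.
have -> : (\int[distribution P V]_y y%:E = \int[P]_y (V y)%:E)%E.
  by apply: integral_distribution => //; exact/measurable_EFinP.
have -> : (\int[P]_y (U y)%:E = \int[distribution P U]_x x%:E)%E.
  by apply/esym/integral_distribution => //; exact/measurable_EFinP.
rewrite -(fineK (integrable_fin_num _ iV))//.
exact: (integralZr _ iUd).
Qed.

End Joint.

End IndependentProduct.

(** * Finite sums and constants under the integral *)

Section RintegralSum.
Context {R : realType} {d : measure_display} {T : measurableType d}.
Variable mu : {measure set T -> \bar R}.

Lemma integrable_sum_EFin (I : Type) (s : seq I) (D : set T) (f : I -> T -> R) :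
  measurable D -> (forall i, mu.-integrable D (EFin \o f i)) ->
  mu.-integrable D (EFin \o (fun t => \sum_(i <- s) f i t)).
Proof.
move=> mD fi.
have := @integrable_sum _ _ _ mu _ mD _ s xpredT _ (fun i _ => fi i).
by congr (_.-integrable _ _); apply/funext => t /=; rewrite sumEFin.
Qed.

Lemma Rintegral_sum (I : Type) (s : seq I) (D : set T) (f : I -> T -> R) :
  measurable D -> (forall i, mu.-integrable D (EFin \o f i)) ->
  \int[mu]_(t in D) (\sum_(i <- s) f i t) = \sum_(i <- s) \int[mu]_(t in D) f i t.
Proof.
move=> mD fi; elim: s => [|i s IHs].
  rewrite big_nil; under eq_Rintegral do rewrite big_nil.
  by rewrite Rintegral_cst// mul0r.
rewrite big_cons -IHs -RintegralD//; last exact: integrable_sum_EFin.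
by under eq_Rintegral do rewrite big_cons.
Qed.

End RintegralSum.

Lemma Rintegral_prob_cst {R : realType} d (T : measurableType d)
  (P : probability T R) (c : R) : \int[P]_t c = c.
Proof.
rewrite Rintegral_cst// -[RHS]mulr1; congr (_ * _).
by have /(congr1 fine) := probability_setT P.
Qed.

(** * A deviation bound for sample means *)

Section WeakLaw.
Context {R : realType} {d : measure_display} {T : measurableType d}.
Variable P : probability T R.
Local Notation integrable f := (P.-integrable [set: T] (EFin \o f)).

Lemma bounded_integrable (f : T -> R) (C : R) : measurable_fun [set: T] f ->
  (forall t, `|f t| <= C) -> integrable f.
Proof.
move=> mf fC; apply: measurable_bounded_integrable => //.
  by rewrite -ge0_fin_numE// fin_num_measure.
exists C; split; first exact: num_real.
by move=> M CM t _; exact: le_trans (fC t) (ltW CM).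
Qed.

Lemma markov_ge1 (g : T -> R) (E : set T) : measurable E -> integrable g ->
  (forall t, 0 <= g t) -> (forall t, E t -> 1 <= g t) ->
  (P E <= (\int[P]_t g t)%:E)%E.
Proof.
move=> mE ig g0 gE.
have mg := measurable_int _ ig.
have := @le_integral_abse _ _ _ P _ measurableT _ _ mg ltr01.
rewrite mul1e setTI => /(le_trans _) h.
apply: le_trans (h _ _) _.
  apply: le_measure; rewrite ?inE//; last first.
    by move=> t Et /=; rewrite lee_fin ger0_norm// gE.
  rewrite -[X in measurable X]setTI; apply: emeasurable_fun_c_infty => //.
  exact: measurableT_comp.
rewrite /Rintegral fineK ?integrable_fin_num//.
rewrite (eq_integral (fun t => (g t)%:E))// => t _.
by rewrite /= ger0_norm.
Qed.

(** Chebyshev controls the mean of the bounded, pairwise orthogonal [f i], whose second moment is at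
    most [C ^+ 2 / n%:R]; Markov controls the mean of the remainders [r i]. Each is allowed half of
    the deviation [e], whence the factors [2 / e]. *)
Lemma weak_law_bound (n : nat) (f r : 'I_n -> T -> R) (C tau e : R) :
  (0 < n)%N -> 0 < e ->
  (forall i, measurable_fun [set: T] (f i)) ->
  (forall i t, `|f i t| <= C) ->
  (forall i j, i != j -> \int[P]_t (f i t * f j t) = 0) ->
  (forall i, integrable (r i)) ->
  (forall i, \int[P]_t `|r i t| <= tau) ->
  (P [set t | (e < `|n%:R^-1 * \sum_i (f i t + r i t)|)%R]
    <= ((2 / e) ^+ 2 * (C ^+ 2 / n%:R) + (2 / e) * tau)%:E)%E.
Proof.
move=> n0 e0 mf fC fij ir rtau.
have n0' : (0 : R) < n%:R by rewrite ltr0n.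
have iff' i j : integrable (fun t => f i t * f j t).
  apply: (@bounded_integrable _ (C * C)) => [|t].
    exact: measurable_funM.
  by rewrite normrM ler_pM.
(* On the event, the mean of [f] or that of [r] is at least [e / 2], so [1 <= g]. *)
pose g t := (2 / e) ^+ 2 * (n%:R^-1 ^+ 2 * \sum_i \sum_j f i t * f j t)
            + (2 / e) * (n%:R^-1 * \sum_i `|r i t|).
have iff2 : integrable (fun t => \sum_i \sum_j f i t * f j t).
  by apply: integrable_sum_EFin => // i; exact: integrable_sum_EFin.
have ir1 : integrable (fun t => \sum_i `|r i t|).
  apply: integrable_sum_EFin => // i; exact: integrable_norm.
have iZ (c : R) (h : T -> R) : integrable h -> integrable (fun t => c * h t).
  by move=> ih; exact: (integrableZl _ c ih).
have ig1 := iZ ((2 / e) ^+ 2) _ (iZ (n%:R^-1 ^+ 2) _ iff2).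
have ig2 := iZ (2 / e) _ (iZ n%:R^-1 _ ir1).
have ig : integrable g by exact: (integrableD _ ig1 ig2).
have sqE t : \sum_i \sum_j f i t * f j t = (\sum_i f i t) ^+ 2.
  by rewrite expr2 mulr_suml; apply: eq_bigr => i _; rewrite mulr_sumr.
apply: le_trans (markov_ge1 _ ig _ _) _.
- have : measurable_fun [set: T]
      (fun t => e < `|n%:R^-1 * \sum_i (f i t + r i t)|).
    apply: measurable_fun_ltr => //; apply: measurableT_comp => //.
    apply: measurable_funM => //; apply: measurable_sum => i.
    apply: measurable_funD => //; apply/measurable_EFinP.
    exact: (measurable_int _ (ir i)).
  by move=> /(_ measurableT [set true] I); rewrite setTI.
- move=> t; rewrite /g sqE.
  apply: addr_ge0; first by rewrite -exprMn -exprMn sqr_ge0.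
  by rewrite !mulr_ge0 ?invr_ge0 ?ler0n ?(ltW e0) ?sumr_ge0.
- move=> t /= et; rewrite /g sqE -exprMn -exprMn big_split/= mulrDr in et *.
  set F := n%:R^-1 * \sum_i f i t in et *.
  set S := n%:R^-1 * \sum_i r i t in et.
  have SS : `|S| <= n%:R^-1 * \sum_i `|r i t|.
    rewrite /S normrM gtr0_norm ?invr_gt0// ler_pM2l ?invr_gt0//.
    exact: ler_norm_sum.
  have e2 : 0 < 2 / e by rewrite divr_gt0.
  have S0 : 0 <= (2 / e) * (n%:R^-1 * \sum_i `|r i t|).
    by apply: mulr_ge0; [exact: ltW|exact: le_trans SS].
  have [Fe|Fe] := leP (e / 2) `|F|.
    apply: ler_wpDr => //; rewrite -real_normK ?num_real// exprn_ege1//.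
    rewrite normrM (gtr0_norm e2).
    have := ler_wpM2l (ltW e2) Fe.
    by rewrite mulrA divfK ?gt_eqF// divff ?pnatr_eq0.
  apply: ler_wpDl; first exact: sqr_ge0.
  apply: le_trans (ler_wpM2l (ltW e2) SS).
  have Se : e / 2 <= `|S|.
    have := ler_normD F S; move: et Fe; lra.
  have := ler_wpM2l (ltW e2) Se.
  by rewrite mulrA divfK ?gt_eqF// divff ?pnatr_eq0.
- rewrite lee_fin /g RintegralD// !RintegralZl// ?iZ//.
  apply: lerD; rewrite ler_pM2l ?exprn_gt0 ?divr_gt0//.
    rewrite Rintegral_sum//; last by move=> i; exact: integrable_sum_EFin.
    (* Orthogonality leaves only the diagonal of the double sum. *)
    have -> : \sum_i \int[P]_t (\sum_j f i t * f j t) =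
        \sum_i \int[P]_t (f i t * f i t).
      apply: eq_bigr => i _; rewrite Rintegral_sum// (bigD1 i)//=.
      by rewrite big1 ?addr0// => j ji; rewrite fij// eq_sym.
    have -> : C ^+ 2 / n%:R = n%:R^-1 ^+ 2 * \sum_(i < n) C ^+ 2.
      rewrite sumr_const card_ord -[C ^+ 2 *+ n]mulr_natr; field.
      by rewrite gt_eqF.
    rewrite ler_pM2l ?exprn_gt0 ?invr_gt0//; apply: ler_sum => i _.
    have -> : C ^+ 2 = \int[P]_t (C ^+ 2).
      by rewrite Rintegral_prob_cst.
    apply: le_Rintegral => //; first exact: (bounded_integrable (C := `|C ^+ 2|)).
    move=> t _; rewrite -expr2 -real_normK ?num_real// lerXn2r// nnegrE.
    exact: le_trans (normr_ge0 _) (fC i t).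
  rewrite Rintegral_sum; [|by []|by move=> i; exact: integrable_norm].
  rewrite mulrC ler_pdivrMr//.
  have -> : tau * n%:R = \sum_(i < n) tau.
    by rewrite sumr_const card_ord mulr_natr.
  exact: ler_sum.
Qed.

End WeakLaw.

(** * Rank of a weighted Gram matrix *)

Section NormalMatrix.
Context {R : realFieldType}.

Lemma row_free_injl m n (A : 'M[R]_(m, n)) :
  (forall v : 'cV[R]_n, A *m v = 0 -> v = 0) -> \rank A = n.
Proof.
move=> inj; apply/eqP; rewrite -mxrank_tr -/(row_free A^T) -kermx_eq0.
apply/eqP/row_matrixP => i; rewrite row0; apply: trmx_inj; rewrite trmx0.
apply: inj; apply: trmx_inj; rewrite trmx_mul trmxK trmx0.
by rewrite -row_mul mulmx_ker row0.
Qed.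

(** The quadratic form of the Gram matrix at [v] is the sum of the [w k * (D *m v) k 0 ^+ 2], so
    with positive weights it vanishes only if [D *m v = 0]. The rank condition thus becomes the
    nonvanishing of a polynomial in the entries, which is open and measurable. *)
Lemma rank_wgram m n (w : 'I_m -> R) (D : 'M[R]_(m, n)) :
  (forall k, 0 < w k) ->
  (\rank D == n) = (\det (D^T *m diag_mx (\row_k w k) *m D) != 0).
Proof.
move=> w0; set A := _ *m D.
rewrite -unitfE -unitmxE -row_full_unit.
apply/eqP/eqP => [rD|rA]; last first.
  apply/eqP; rewrite eqn_leq rank_leq_col -{1}rA; exact: mxrankM_maxr.
apply: row_free_injl => v Av0.
suff Dv0 : D *m v = 0.
  have : row_free D^T by rewrite /row_free mxrank_tr rD.
  move/row_free_inj => inj; apply: trmx_inj; apply: inj.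
  by rewrite -trmx_mul Dv0 !trmx0 mul0mx.
have : \sum_k w k * (D *m v) k 0 ^+ 2 = 0.
  suff -> : \sum_k w k * (D *m v) k 0 ^+ 2 = (v^T *m (A *m v)) 0 0.
    by rewrite Av0 mulmx0 mxE.
  rewrite /A !mulmxA -trmx_mul -mulmxA -mulmxA mxE; apply: eq_bigr => k _.
  by move: (D *m v) => u; rewrite mul_diag_mx !mxE mulrCA.
move=> /eqP; rewrite psumr_eq0 => [/allP h|k _]; last first.
  by rewrite mulr_ge0 ?sqr_ge0// ltW.
apply/colP => k; rewrite [RHS]mxE; apply/eqP.
have := h k (mem_index_enum _); rewrite /= mulf_eq0 gt_eqF//=.
by rewrite sqrf_eq0.
Qed.

End NormalMatrix.

(** * Limits in probability of matrices *)

Section MatrixConvergence.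
Context {R : realType} {d : measure_display} {T : measurableType d}.
Variable P : probability T R.

Definition mx_pcvg m n (Z : nat -> T -> 'M[R]_(m, n)) (z : 'M[R]_(m, n)) :=
  forall i j, pcvg P (fun k t => Z k t i j) (z i j).

Lemma eq_pcvg (Z Z' : nat -> T -> R) z z' : (forall k t, Z k t = Z' k t) ->
  z = z' -> pcvg P Z z -> pcvg P Z' z'.
Proof.
by move=> ZZ' <-; congr pcvg; apply/funext => k; apply/funext => t.
Qed.

Lemma mx_pcvg_cst m n (z : 'M[R]_(m, n)) : mx_pcvg (fun _ _ => z) z.
Proof. by move=> i j; exact: pcvg_cst. Qed.

Lemma mx_pcvg_tr m n Z (z : 'M[R]_(m, n)) : mx_pcvg Z z ->
  mx_pcvg (fun k t => (Z k t)^T) z^T.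
Proof.
by move=> Zz i j; apply: eq_pcvg (Zz j i) => [k t|]; rewrite mxE.
Qed.

Lemma mx_pcvgM m n p Z Z' (z : 'M[R]_(m, n)) (z' : 'M[R]_(n, p)) :
  mx_pcvg Z z -> mx_pcvg Z' z' -> mx_pcvg (fun k t => Z k t *m Z' k t) (z *m z').
Proof.
move=> Zz Zz' i j.
apply: (@eq_pcvg (fun k t => \sum_l Z k t i l * Z' k t l j)
  _ (\sum_l z i l * z' l j)) => [k t||]; rewrite ?mxE//.
by apply: pcvg_sum => l; exact: pcvgM.
Qed.

Lemma pcvg_det_mx n Z (z : 'M[R]_n) : mx_pcvg Z z ->
  pcvg P (fun k t => \det (Z k t)) (\det z).
Proof.
move=> Zz; rewrite /determinant; apply: pcvg_sum => s.
by apply: pcvgM; [exact: pcvg_cst|apply: pcvg_prod => i; exact: Zz].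
Qed.

(** Cofactors are polynomial in the entries. Adjugate and determinant stand in for the matrix
    inverse, so that singular matrices need no case distinction. *)
Lemma mx_pcvg_adj n Z (z : 'M[R]_n) : mx_pcvg Z z ->
  mx_pcvg (fun k t => \adj (Z k t)) (\adj z).
Proof.
move=> Zz i j.
apply: (@eq_pcvg (fun k t => cofactor (Z k t) j i) _ (cofactor z j i))
  => [k t||]; rewrite ?mxE//.
rewrite /cofactor; apply: pcvgM; first exact: pcvg_cst.
apply: pcvg_det_mx => a b.
apply: (@eq_pcvg (fun k t => Z k t (lift j a) (lift i b)) _
  (z (lift j a) (lift i b)))
  => [k t||]; rewrite ?mxE//.
Qed.

End MatrixConvergence.

(** * The weak law of large numbers for arrays of samples *)

Section WeakLawArray.
Context {R : realType} {d d' : measure_display} {T : measurableType d}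
  {T' : measurableType d'}.
Variables (P : probability T R) (Q : probability T' R).

Section Transfer.
Variables (S : {RV P >-> T'}) (h : T' -> R).
Hypothesis lawS : forall B, measurable B -> P (S @^-1` B) = Q B.
Hypothesis ih : Q.-integrable [set: T'] (EFin \o h).

Let mh : measurable_fun [set: T'] (EFin \o h) := measurable_int _ ih.

Lemma integrable_transfer : P.-integrable [set: T] (EFin \o (h \o S)).
Proof.
apply/integrableP; split; first exact: (measurableT_comp mh).
case/integrableP : ih => _; apply: le_lt_trans.
rewrite (eq_measure_integral (distribution P S)); last first.
  by move=> A mA _; exact/esym/lawS.
rewrite ge0_integral_distribution//; exact: measurableT_comp.
Qed.

Lemma Rintegral_transfer : \int[P]_t h (S t) = \int[Q]_y h y.
Proof.
rewrite /Rintegral; congr fine.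
rewrite [RHS](eq_measure_integral (distribution P S)); last first.
  by move=> A mA _; exact/esym/lawS.
by rewrite integral_distribution//; exact: integrable_transfer.
Qed.

End Transfer.

Section WLLN.
Variable g : T' -> R.
Hypothesis mg : measurable_fun [set: T'] g.
Hypothesis ig : Q.-integrable [set: T'] (EFin \o g).

Let trunc (M : R) (y : T') : R := if `|g y| <= M then g y else 0.

Let mtrunc M : measurable_fun [set: T'] (trunc M).
Proof.
apply: measurable_fun_ifT => //; apply: measurable_fun_ler => //.
exact: measurableT_comp.
Qed.

Let trunc_bound M y : 0 <= M -> `|trunc M y| <= M.
Proof. by rewrite /trunc; case: ifP => // _ M0; rewrite normr0. Qed.

Let itrunc M : 0 <= M -> Q.-integrable [set: T'] (EFin \o trunc M).
Proof.
move=> M0; apply: (@bounded_integrable _ _ _ Q _ M) => // y.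
exact: trunc_bound.
Qed.

(** Dominated convergence with dominating function [|g|]: at each point the truncation is exact as
    soon as its level exceeds [|g|] there. *)
Let tail (tau : R) : 0 < tau ->
  exists2 M, 0 <= M & \int[Q]_y `|g y - trunc M y| <= tau.
Proof.
move=> tau0.
have [|||||_ + _] := @dominated_convergence _ _ _ Q _ measurableT
  (fun n y => (trunc n%:R y)%:E) (EFin \o g) (abse \o (EFin \o g)).
- by move=> n; exact/measurable_EFinP.
- exact/measurable_EFinP.
- apply: aeW => y _; apply: cvg_near_cst.
  exists (Num.truncn `|g y|).+1 => // n /= yn; rewrite /trunc ifT//.
  apply: (le_trans (ltW (truncnS_gt _))); rewrite ler_nat//.
- exact: integrable_abse.
- apply: aeW => y n _ /=; rewrite lee_fin /trunc.
  by case: ifP => // _; rewrite normr0.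
move=> /fine_cvgP[_ /cvgrPdist_le/(_ tau tau0)[N _ /(_ N (leqnn _))]] /=.
rewrite sub0r normrN => h; exists N%:R => //.
apply: le_trans (le_trans (ler_norm _) h).
rewrite le_eqVlt; apply/orP; left; apply/eqP; congr fine.
by apply: eq_integral => y _; rewrite /= distrC.
Qed.

Variables (n : nat -> nat) (S : forall m, 'I_(n m) -> {RV P >-> T'}).
Arguments S : clear implicits.
Hypothesis lawS : forall m i B, measurable B -> P (S m i @^-1` B) = Q B.
Hypothesis indepS : forall m i j A B, i != j -> measurable A -> measurable B ->
  P (S m i @^-1` A `&` S m j @^-1` B) =
  (P (S m i @^-1` A) * P (S m j @^-1` B))%E.
Hypothesis n_oo : n @ \oo --> \oo.

(** Truncation at a fixed level splits [g] into a bounded part, whose mean has variance of order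
    [1 / n m], and a remainder that is small in L1; [weak_law_bound] applies to both once they are
    centred. *)
Lemma weak_law :
  pcvg P (fun m t => (n m)%:R^-1 * \sum_i g (S m i t)) (\int[Q]_y g y).
Proof.
set mu := \int[Q]_y g y.
have mS m : measurable_fun [set: T] (fun t => (n m)%:R^-1 * \sum_i g (S m i t)).
  apply: measurable_funM => //; apply: measurable_sum => i.
  exact: measurableT_comp.
apply: pcvgP => // e e0.
have finP m : P [set t | (e < `|(n m)%:R^-1 * \sum_i g (S m i t) - mu|)%R]
    \is a fin_num.
  apply: fin_num_measure.
  have : measurable_fun [set: T]
      (fun t => e < `|(n m)%:R^-1 * \sum_i g (S m i t) - mu|).
    apply: measurable_fun_ltr => //; apply: measurableT_comp => //.
    exact: measurable_funB.
  by move=> /(_ measurableT [set true] I); rewrite setTI.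
apply/fine_cvgP; split; first exact: nearW finP.
apply/cvgrPdist_le => eta eta0.
(* Centring the remainder at most doubles its L1 norm, to [eta * e / 4], and the factor [2 / e] of
   the bound turns this into [eta / 2]. *)
have [M M0 tailM] := tail (divr_gt0 (mulr_gt0 eta0 e0) (ltr0n R 8)).
pose muM := \int[Q]_y trunc M y.
(* From this sample size on, the second moment term of the bound is at most the other [eta / 2]. *)
pose K := (Num.truncn ((2 / e) ^+ 2 * (M + `|muM|) ^+ 2 / (eta / 2))).+1.
have nK : \forall m \near \oo, (K <= n m)%N := n_oo (nbhs_infty_ge K).
near=> m.
have Kn : (K <= n m)%N by near: m.
have n0 : (0 < n m)%N by exact: leq_trans Kn.
have n0' : (0 : R) < (n m)%:R by rewrite ltr0n.
(* The centred truncation and the centred remainder: [f y + r y] is [g y - mu]. *)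
pose f y := trunc M y - muM.
pose r y := (g y - trunc M y) - (mu - muM).
have icst (c : R) : Q.-integrable [set: T'] (EFin \o (fun=> c)).
  by apply: (@bounded_integrable _ _ _ Q _ `|c|).
have itM := itrunc M0.
have mf : measurable_fun [set: T'] f by exact: measurable_funB.
have fC y : `|f y| <= M + `|muM|.
  by apply: le_trans (ler_normB _ _) _; rewrite lerD2r trunc_bound.
have if_ : Q.-integrable [set: T'] (EFin \o f).
  exact: (@bounded_integrable _ _ _ Q _ _ mf fC).
have igt : Q.-integrable [set: T'] (EFin \o (fun y => g y - trunc M y)).
  exact: (integrableB _ ig itM).
have ir : Q.-integrable [set: T'] (EFin \o r).
  exact: (integrableB _ igt (icst _)).
have f0 : \int[Q]_y f y = 0.
  rewrite /f RintegralB; [|by []|exact: itM|exact: icst].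
  by rewrite Rintegral_prob_cst subrr.
have r_tau : \int[Q]_y `|r y| <= eta * e / 4.
  have mumuM : `|mu - muM| <= \int[Q]_y `|g y - trunc M y|.
    rewrite /mu /muM -RintegralB//; exact: le_normr_Rintegral.
  apply: (@le_trans _ _ (\int[Q]_y (`|g y - trunc M y| + `|mu - muM|))).
    apply: le_Rintegral => //; first exact: integrable_norm.
      apply: (integrableD _ (integrable_norm igt) (icst _)) => //.
    by move=> y _; exact: ler_normB.
  rewrite RintegralD; [|by []|exact: integrable_norm|exact: icst].
  rewrite Rintegral_prob_cst.
  move: mumuM tailM; lra.
have mfS i : measurable_fun [set: T] (f \o S m i) by exact: measurableT_comp.
have fS0 i j : i != j -> \int[P]_t ((f \o S m i) t * (f \o S m j) t) = 0.
  move=> ij.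
  have ifS k : P.-integrable [set: T] (EFin \o (f \o S m k)).
    exact: (integrable_transfer (@lawS m k) if_).
  rewrite (Rintegral_indepM (mfS i) (mfS j) _ (ifS i) (ifS j)).
    by rewrite (Rintegral_transfer (@lawS m i))// f0 mul0r.
  move=> A B mA mB; apply: (@indepS m i j (f @^-1` A) (f @^-1` B)) => //.
    by rewrite -[X in measurable X]setTI; exact: mf.
  by rewrite -[X in measurable X]setTI; exact: mf.
have irS i : P.-integrable [set: T] (EFin \o (r \o S m i)).
  exact: (integrable_transfer (@lawS m i) ir).
have rS_tau i : \int[P]_t `|(r \o S m i) t| <= eta * e / 4.
  by have /= -> := Rintegral_transfer (@lawS m i) (integrable_norm ir).
have bd := weak_law_bound n0 e0 mfS (fun i t => fC (S m i t)) fS0 irS rS_tau.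
rewrite /= sub0r normrN ger0_norm ?fine_ge0//.
have E : [set t | e < `|(n m)%:R^-1 * \sum_i g (S m i t) - mu|] =
  [set t | e < `|(n m)%:R^-1 * \sum_i ((f \o S m i) t + (r \o S m i) t)|].
  apply: eq_set => t; congr (is_true (_ < `| _ |)).
  rewrite [in RHS](eq_bigr (fun i => g (S m i t) - mu)) => [|i _]; last first.
    by rewrite /f /r /=; ring.
  by rewrite sumrB sumr_const card_ord mulrBr -[mu *+ _]mulr_natl mulKf ?gt_eqF.
rewrite E -lee_fin fineK; last by rewrite -E; exact: finP.
apply: le_trans bd _; rewrite lee_fin.
have -> : 2 / e * (eta * e / 4) = eta / 2 by field; rewrite gt_eqF.
suff : (2 / e) ^+ 2 * ((M + `|muM|) ^+ 2 / (n m)%:R) <= eta / 2 by lra.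
rewrite mulrA ler_pdivrMr// -ler_pdivrMl ?divr_gt0// mulrC.
apply: le_trans (ltW (truncnS_gt _)) _.
by rewrite ler_nat.
Unshelve. all: by end_near.
Qed.

End WLLN.
End WeakLawArray.

(** * Expectation conditional on an event *)

Section ConditionalMeasure.
Context {R : realType} {d : measure_display} {T : measurableType d}.
Variables (P : probability T R) (B : set T).
Hypotheses (mB : measurable B) (PB : (0 < P B)%E).
Local Notation integrable f := (P.-integrable [set: T] (EFin \o f)).

(** The last argument of [mnormalize] is only a default value, for [P B = 0]. *)
Definition cond_measure : probability T R := mnormalize (mrestr P mB) P.

Let PB_fin : P B \is a fin_num.
Proof. exact: fin_num_measure. Qed.

Let c : R := (fine (P B))^-1.

Let c_ge0 : 0 <= c.
Proof. by rewrite invr_ge0 fine_ge0. Qed.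

Let cond_measureM A : cond_measure A = (P (A `&` B) * c%:E)%E.
Proof.
rewrite /cond_measure /= /mnormalize /= /mrestr setTI.
rewrite ifF//; apply/negbTE; rewrite negb_or gt_eqF//=.
by move: PB_fin; rewrite fin_numE => /andP[].
Qed.

Lemma cond_measureE A : measurable A -> cond_measure A = (cond_prob P A B)%:E.
Proof.
move=> mA; rewrite cond_measureM /cond_prob EFinM fineK//.
by apply: fin_num_measure; exact: measurableI.
Qed.

(** The conditional measure is a rescaled restriction of [P]; the complement of [B] is negligible
    for it, so only the integral over [B] remains. *)
Let ge0_integral_cond (h : T -> \bar R) : measurable_fun [set: T] h ->
  (forall t, 0 <= h t)%E ->
  (\int[cond_measure]_t h t = c%:E * \int[P]_(t in B) h t)%E.
Proof.
move=> mh h0; pose r : {nonneg R} := NngNum c_ge0.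
rewrite (eq_measure_integral (mscale r (mrestr P mB))); last first.
  by move=> A mA _; rewrite /= cond_measureM /mscale /= muleC.
rewrite ge0_integral_mscale//; congr (_ * _)%E.
rewrite (@ge0_negligible_integral _ _ _ _ setT (~` B))//=.
- rewrite setTD setCK; apply: eq_measure_integral => A mA AB.
  by rewrite /= /mrestr (setIidl AB).
- exact: measurableC.
- by rewrite /mrestr setICl measure0.
Qed.

Variable f : T -> R.
Hypothesis fi : integrable f.

Lemma integrable_cond_measure : cond_measure.-integrable [set: T] (EFin \o f).
Proof.
case/integrableP : (fi) => mf foo; apply/integrableP; split=> //.
rewrite ge0_integral_cond//; last exact: measurableT_comp.
apply: lte_mul_pinfty => //.
by case/integrableP : (integrableS measurableT mB (@subsetT _ _) fi).
Qed.

(** Turns a conditional expectation into an ordinary one, to which the law of large numbers applies.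
    The nonnegative case is used on the positive and negative parts. *)
Lemma Rintegral_cond_measure : \int[cond_measure]_t f t = cond_exp P f B.
Proof.
have mf := measurable_int _ fi.
have fiB := integrableS measurableT mB (@subsetT _ _) fi.
rewrite /cond_exp /Rintegral mulrC -/c -[c]/(fine c%:E) -fineM//; last first.
  exact: integrable_fin_num.
congr fine; rewrite integralE [in RHS]integralE.
rewrite !ge0_integral_cond//;
  [|exact: measurable_funeneg|exact: measurable_funepos].
rewrite -muleBr//; apply: fin_num_adde_defl.
by rewrite fin_numN; exact: integrable_neg_fin_num.
Qed.

End ConditionalMeasure.

(** * Square integrability and rules for conditional expectations *)

Section SquareIntegrable.
Context {R : realType} {d : measure_display} {T : measurableType d}.
Variable P : probability T R.
Local Notation integrable f := (P.-integrable [set: T] (EFin \o f)).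

Lemma integrable_le (f g : T -> R) : measurable_fun [set: T] f ->
  (forall t, `|f t| <= g t) -> integrable g -> integrable f.
Proof.
move=> mf fg ig; apply: le_integrable ig => //; first exact/measurable_EFinP.
by move=> t _ /=; rewrite lee_fin (le_trans (fg t))// ler_norm.
Qed.

Lemma integrable_sqrM (f g : T -> R) :
  measurable_fun [set: T] f -> measurable_fun [set: T] g ->
  integrable (fun t => f t ^+ 2) -> integrable (fun t => g t ^+ 2) ->
  integrable (fun t => f t * g t).
Proof.
move=> mf mg if2 ig2.
apply: (integrable_le (g := fun t => f t ^+ 2 + g t ^+ 2)).
- exact: measurable_funM.
- move=> t; rewrite ler_norml; apply/andP; split; nra.
- exact: (integrableD _ if2 ig2).
Qed.

Lemma integrable_sqr (f : T -> R) : measurable_fun [set: T] f ->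
  integrable (fun t => f t ^+ 2) -> integrable f.
Proof.
move=> mf if2.
have i1 : integrable (fun=> 1 : R).
  exact: (@bounded_integrable _ _ _ P (fun=> 1) `|1|).
apply: (integrable_le (g := fun t => f t ^+ 2 + 1)) => //.
- by move=> t; rewrite ler_norml; apply/andP; split; nra.
- exact: (integrableD _ if2 i1).
Qed.

Variable B : set T.
Hypothesis mB : measurable B.

Let iB (f : T -> R) : integrable f -> P.-integrable B (EFin \o f).
Proof. exact: (integrableS measurableT mB (@subsetT _ _)). Qed.

Lemma cond_expD (f g : T -> R) : integrable f -> integrable g ->
  cond_exp P (fun t => f t + g t) B = cond_exp P f B + cond_exp P g B.
Proof. by move=> fi gi; rewrite /cond_exp RintegralD ?mulrDl// iB. Qed.

Lemma cond_expZ (c : R) (f : T -> R) : integrable f ->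
  cond_exp P (fun t => c * f t) B = c * cond_exp P f B.
Proof. by move=> fi; rewrite /cond_exp RintegralZl ?mulrA// iB. Qed.

Lemma cond_exp_sum (I : Type) (s : seq I) (f : I -> T -> R) :
  (forall i, integrable (f i)) ->
  cond_exp P (fun t => \sum_(i <- s) f i t) B = \sum_(i <- s) cond_exp P (f i) B.
Proof.
by move=> fi; rewrite /cond_exp Rintegral_sum ?mulr_suml// => i; exact: iB.
Qed.

Lemma cond_exp_cst (c : R) : (0 < P B)%E -> cond_exp P (fun=> c) B = c.
Proof.
move=> PB; rewrite /cond_exp Rintegral_cst// mulfK// gt_eqF// fine_gt0// PB.
by rewrite -ge0_fin_numE// fin_num_measure.
Qed.

(** Allows the linear model, which holds only almost surely, to be substituted under conditional
    expectations. *)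
Lemma cond_exp_ae (f g : T -> R) : measurable_fun [set: T] f ->
  measurable_fun [set: T] g -> {ae P, forall t, f t = g t} ->
  cond_exp P f B = cond_exp P g B.
Proof.
move=> mf mg fg; rewrite /cond_exp /Rintegral; congr (fine _ / _).
apply: ae_eq_integral => //.
- by apply: measurable_funTS; exact/measurable_EFinP.
- by apply: measurable_funTS; exact/measurable_EFinP.
- by apply: filterS fg => t ftg _; congr EFin.
Qed.

End SquareIntegrable.

(** * Population moments in the linear model *)

Section Population.
Context {R : realType} {d0 : measure_display} {T0 : measurableType d0}.
Variables (P0 : probability T0 R) (K d : nat).
Variables (Y eps : {RV P0 >-> R}) (X : {RV P0 >-> d.-tuple R}) (G : T0 -> 'I_K).
Variables (beta0 : R) (beta : 'I_d -> R) (sigma2 : R).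
Hypothesis mG : sigma_discrete G `<=` measurable.
Hypothesis G_pos : forall k, (0 < P0 (G @^-1` [set k]))%E.
Hypothesis model : {ae P0, forall t,
  Y t = beta0 + \sum_(j < d) beta j * tnth (X t) j + eps t}.
Hypothesis eps_indep :
  independent2 P0 (sigma_of eps) <<s sigma_of X `|` sigma_discrete G >>.
Hypothesis eps_mean : ('E_P0[eps] = 0)%E.
Hypothesis eps_var : ('V_P0[eps] = sigma2%:E)%E.
Hypothesis Y_L2 : ('E_P0[(fun t => Y t ^+ 2)%R] < +oo)%E.
Hypothesis X_L2 : ('E_P0[(fun t => enorm (col_of_tuple (X t)) ^+ 2)%R] < +oo)%E.
Local Notation integrable f := (P0.-integrable [set: T0] (EFin \o f)).
Local Notation Gk k := (G @^-1` [set k]).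
Local Notation E k f := (cond_exp P0 f (Gk k)).

Lemma measurable_group k : measurable (Gk k).
Proof. by apply: mG; exists [set k] => //; rewrite setTI. Qed.

Lemma measurable_coord j : measurable_fun [set: T0] (fun t => tnth (X t) j).
Proof. exact: (measurableT_comp (measurable_tnth j)). Qed.

Lemma integrable_Y2 : integrable (fun t => Y t ^+ 2).
Proof.
move: Y_L2; rewrite unlock => Y2; apply/integrableP; split.
  by apply/measurable_EFinP; exact: measurable_funX.
apply: le_lt_trans Y2; rewrite le_eqVlt; apply/orP; left; apply/eqP.
by apply: eq_integral => t _; rewrite /= ger0_norm ?sqr_ge0.
Qed.

Lemma integrable_coord2 j : integrable (fun t => tnth (X t) j ^+ 2).
Proof.
have nE t : enorm (col_of_tuple (X t)) ^+ 2 = \sum_i tnth (X t) i ^+ 2.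
  rewrite sqr_sqrtr ?sumr_ge0// => [|i _]; last exact: sqr_ge0.
  by apply: eq_bigr => i _; rewrite mxE.
move: X_L2; rewrite unlock; under eq_integral do rewrite nE.
move=> X2; apply/integrableP; split.
  by apply/measurable_EFinP/measurable_funX; exact: measurable_coord.
apply: le_lt_trans X2; apply: ge0_le_integral => //.
- apply: measurableT_comp => //; apply/measurable_EFinP/measurable_funX.
  exact: measurable_coord.
- apply/measurable_EFinP/measurable_sum => i; apply: measurable_funX.
  exact: measurable_coord.
- move=> t _; rewrite lee_fin ger0_norm ?sqr_ge0// (bigD1 j)//= lerDl.
  by rewrite sumr_ge0// => i _; exact: sqr_ge0.
Qed.

Lemma integrable_Y : integrable Y.
Proof. by apply: integrable_sqr => //; exact: integrable_Y2. Qed.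

Lemma integrable_coord j : integrable (fun t => tnth (X t) j).
Proof.
by apply: integrable_sqr; [exact: measurable_coord|exact: integrable_coord2].
Qed.

Lemma integrable_coordM i j : integrable (fun t => tnth (X t) i * tnth (X t) j).
Proof.
apply: integrable_sqrM; [exact: measurable_coord|exact: measurable_coord|..];
  exact: integrable_coord2.
Qed.

Let L t := \sum_(j < d) beta j * tnth (X t) j.

Let mL : measurable_fun [set: T0] L.
Proof.
apply: measurable_sum => j; apply: measurable_funM => //.
exact: measurable_coord.
Qed.

Let scale_integrable (c : R) (f : T0 -> R) : integrable f ->
  integrable (fun t => c * f t).
Proof. by move=> fi; exact: (integrableZl _ c fi). Qed.

Let iL : integrable L.
Proof.
apply: integrable_sum_EFin => // j; apply: scale_integrable.
exact: integrable_coord.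
Qed.

Let sqrL t : L t ^+ 2 =
  \sum_(i < d) \sum_(j < d) beta i * beta j * (tnth (X t) i * tnth (X t) j).
Proof.
rewrite /L expr2 mulr_suml; apply: eq_bigr => i _; rewrite mulr_sumr.
by apply: eq_bigr => j _; rewrite mulrACA.
Qed.

Let iL2 : integrable (fun t => L t ^+ 2).
Proof.
under [X in integrable X]eq_fun do rewrite sqrL.
apply: integrable_sum_EFin => // i; apply: integrable_sum_EFin => // j.
by apply: scale_integrable; exact: integrable_coordM.
Qed.

(** The noise equals almost surely the residual [r], which is square integrable because [Y] and the
    regression function are. *)
Let ieps2 : integrable (fun t => eps t ^+ 2).
Proof.
pose r t := Y t - (beta0 + L t).
have mr : measurable_fun [set: T0] r.
  by apply: measurable_funB => //; exact: measurable_funD.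
have ir : integrable (fun t => r t ^+ 2).
  (* The 3 is the number of terms in the residual: the square of a sum of three terms is at most 3
     times the sum of their squares. *)
  apply: (integrable_le (g := fun t => 3 * (Y t ^+ 2 + (beta0 ^+ 2 + L t ^+ 2)))).
  - exact: measurable_funX.
  - move=> t; rewrite ger0_norm ?sqr_ge0// /r.
    rewrite -subr_ge0.
    have -> : 3 * (Y t ^+ 2 + (beta0 ^+ 2 + L t ^+ 2))
        - (Y t - (beta0 + L t)) ^+ 2 =
        (Y t + beta0) ^+ 2 + (Y t + L t) ^+ 2 + (beta0 - L t) ^+ 2 by ring.
    by rewrite !addr_ge0 ?sqr_ge0.
  - have ic : integrable (fun=> beta0 ^+ 2).
      exact: (@bounded_integrable _ _ _ P0 (fun=> beta0 ^+ 2) `|beta0 ^+ 2|).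
    have icL : integrable (fun t => beta0 ^+ 2 + L t ^+ 2).
      exact: (integrableD _ ic iL2).
    by apply: scale_integrable; exact: (integrableD _ integrable_Y2 icL).
case/integrableP : ir => mr2 ir; apply/integrableP; split.
  by apply/measurable_EFinP; exact: measurable_funX.
apply: le_lt_trans ir; rewrite le_eqVlt; apply/orP; left; apply/eqP.
apply: ge0_ae_eq_integral => //.
- apply: measurableT_comp => //; apply/measurable_EFinP; exact: measurable_funX.
- exact: measurableT_comp.
- apply: filterS model => t Yt _ /=; rewrite /r Yt -/(L t); congr (`| _ ^+ 2|%:E).
  ring.
Qed.

Let ieps : integrable eps.
Proof. exact: integrable_sqr. Qed.

Let eps0 : \int[P0]_t eps t = 0.
Proof. by rewrite /Rintegral; move: eps_mean; rewrite unlock => ->. Qed.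

Let epsvar : \int[P0]_t (eps t ^+ 2) = sigma2.
Proof.
move: eps_var; rewrite /variance unlock eps_mean /= unlock => epsvar.
rewrite /Rintegral -[RHS]/(fine sigma2%:E) -epsvar; congr fine.
apply: eq_integral => t _; congr EFin.
by rewrite -[RHS]/((eps t - 0) * (eps t - 0)) subr0 expr2.
Qed.

Section Independence.
Variables (k : 'I_K) (h : d.-tuple R -> R).
Hypothesis mh : measurable_fun [set: d.-tuple R] h.
Let W t := h (X t) * \1_(Gk k) t.

Let mW : measurable_fun [set: T0] W.
Proof.
apply: measurable_funM; first exact: measurableT_comp.
by apply: measurable_indic; exact: measurable_group.
Qed.

Let W_XG (A : set R) : measurable A ->
  <<s sigma_of X `|` sigma_discrete G >> (W @^-1` A).
Proof.
set F := sigma_of X `|` sigma_discrete G.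
have : measurable_fun [set: g_sigma_algebraType F] W.
  apply: measurable_funM.
    apply: measurableT_comp => // _ B mB; rewrite setTI.
    by apply: sub_sigma_algebra; left; exists B => //; rewrite setTI.
  apply: measurable_indic; apply: sub_sigma_algebra; right.
  by exists [set k] => //; rewrite setTI.
by move=> mW' mA; have := mW' measurableT A mA; rewrite setTI.
Qed.

(** Restricting to a group multiplies the integrand by an indicator. The factor [W] made of
    [h (X t)] and this indicator is measurable for the sigma-algebra of [X] and [G], hence
    independent of [eps]. *)
Lemma eps_indepM (f : R -> R) : measurable_fun [set: R] f ->
  integrable (fun t => h (X t)) -> integrable (f \o eps) ->
  E k (fun t => f (eps t) * h (X t)) =
  (\int[P0]_t f (eps t)) * E k (fun t => h (X t)).
Proof.
move=> mf ih ife.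
have iW : integrable W.
  apply: (integrable_le (g := fun t => `|h (X t)|)) => //.
    move=> t; rewrite /W normrM ler_piMr// indicE.
    by case: (_ \in _); rewrite ?normr1 ?normr0.
  exact: integrable_norm.
have WE (u : T0 -> R) : \int[P0]_(t in Gk k) u t = \int[P0]_t (u t * \1_(Gk k) t).
  rewrite Rintegral_mkcond; apply: eq_Rintegral => t _.
  by rewrite patchE indicE; case: ifP => _; rewrite ?mulr1 ?mulr0.
rewrite /cond_exp !WE mulrA; congr (_ / _).
have -> : \int[P0]_t (f (eps t) * h (X t) * \1_(Gk k) t) =
    \int[P0]_t ((f \o eps) t * W t).
  by apply: eq_Rintegral => t _; rewrite mulrA.
apply: Rintegral_indepM => //; first exact: measurableT_comp.
move=> A B mA mB; apply: eps_indep; last exact: W_XG.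
exists (f @^-1` A); rewrite ?setTI//.
by rewrite -[X in measurable X]setTI; exact: mf.
Qed.

End Independence.

Let ELE k : E k L = \sum_(j < d) beta j * E k (fun t => tnth (X t) j).
Proof.
rewrite cond_exp_sum; [|exact: measurable_group|]; last first.
  by move=> j; apply: scale_integrable; exact: integrable_coord.
apply: eq_bigr => j _; rewrite cond_expZ//; first exact: measurable_group.
exact: integrable_coord.
Qed.

Let EL2E k : E k (fun t => L t ^+ 2) = \sum_(i < d) \sum_(j < d)
  beta i * beta j * E k (fun t => tnth (X t) i * tnth (X t) j).
Proof.
have mGk := measurable_group k.
under [X in cond_exp _ X]eq_fun do rewrite sqrL.
have iij i j :
    integrable (fun t => beta i * beta j * (tnth (X t) i * tnth (X t) j)).
  by apply: scale_integrable; exact: integrable_coordM.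
rewrite cond_exp_sum// => [|i]; last exact: integrable_sum_EFin.
apply: eq_bigr => i _; rewrite cond_exp_sum//.
by apply: eq_bigr => j _; rewrite cond_expZ//; exact: integrable_coordM.
Qed.

Let hL (x : d.-tuple R) := \sum_(j < d) beta j * tnth x j.

Let mhL : measurable_fun [set: d.-tuple R] hL.
Proof.
apply: measurable_sum => j; apply: measurable_funM => //.
exact: measurable_tnth.
Qed.

(** With [h] constant equal to 1, [eps_indepM] says that the moments of the noise do not depend on
    the group. *)
Let Eeps k : E k eps = 0.
Proof.
have := @eps_indepM k (fun=> 1) _ id _ _ ieps.
rewrite eps0 mul0r => <- //.
- by congr cond_exp; apply/funext => t; rewrite mulr1.
- exact: (@bounded_integrable _ _ _ P0 (fun=> 1) `|1|).
Qed.

Let Eeps2 k : E k (fun t => eps t ^+ 2) = sigma2.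
Proof.
have i1 : integrable (fun t => 1).
  exact: (@bounded_integrable _ _ _ P0 (fun=> 1) `|1|).
have mx2 : measurable_fun [set: R] (fun x => x ^+ 2) by exact: measurable_funX.
have := @eps_indepM k (fun=> 1) (measurable_cst _) (fun x => x ^+ 2) mx2 i1 ieps2.
rewrite epsvar cond_exp_cst//; last exact: measurable_group.
rewrite mulr1 => <-; congr cond_exp.
by apply/funext => t; rewrite mulr1.
Qed.

Let EepsL k : E k (fun t => eps t * L t) = 0.
Proof.
by have := @eps_indepM k hL mhL id _ iL ieps; rewrite eps0 mul0r => ->.
Qed.

(** The [k]th row of the linear system [mu_Y = mu_{1,X} beta] that the estimator of the coefficients
    solves empirically. *)
Lemma cond_exp_Y k :
  E k Y = beta0 + \sum_(j < d) beta j * E k (fun t => tnth (X t) j).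
Proof.
have mGk := measurable_group k.
have ic : integrable (fun=> beta0).
  exact: (@bounded_integrable _ _ _ P0 (fun=> beta0) `|beta0|).
have icL : integrable (fun t => beta0 + L t) by exact: (integrableD _ ic iL).
rewrite (@cond_exp_ae _ _ _ P0 _ mGk _ (fun t => beta0 + L t + eps t))//;
    last first.
  by apply: measurable_funD => //; exact: measurable_funD.
rewrite (cond_expD mGk icL ieps) (cond_expD mGk ic iL).
by rewrite (cond_exp_cst mGk _ (G_pos k)) Eeps addr0 ELE.
Qed.

(** In the squared model every term linear in [eps] has conditional mean 0, and the squared noise
    contributes the same [sigma2] in every group. *)
Lemma cond_exp_Y2 k : E k (fun t => Y t ^+ 2) =
  beta0 ^+ 2 + sigma2
  + 2 * beta0 * (\sum_(j < d) beta j * E k (fun t => tnth (X t) j))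
  + \sum_(i < d) \sum_(j < d)
      beta i * beta j * E k (fun t => tnth (X t) i * tnth (X t) j).
Proof.
have mGk := measurable_group k.
have ic : integrable (fun=> beta0 ^+ 2).
  exact: (@bounded_integrable _ _ _ P0 (fun=> beta0 ^+ 2) `|beta0 ^+ 2|).
have ieL : integrable (fun t => eps t * L t) by apply: integrable_sqrM.
(* The expanded square of the model; the terms whose conditional mean vanishes come last. *)
pose u t := (beta0 ^+ 2 + eps t ^+ 2) + (2 * beta0 * L t + L t ^+ 2)
  + (2 * beta0 * eps t + 2 * (eps t * L t)).
have i1 : integrable (fun t => beta0 ^+ 2 + eps t ^+ 2).
  exact: (integrableD _ ic ieps2).
have i2L := scale_integrable (2 * beta0) iL.
have i2e := scale_integrable (2 * beta0) ieps.
have i2eL := scale_integrable 2 ieL.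
have i2 : integrable (fun t => 2 * beta0 * L t + L t ^+ 2).
  exact: (integrableD _ i2L iL2).
have i3 : integrable (fun t => 2 * beta0 * eps t + 2 * (eps t * L t)).
  exact: (integrableD _ i2e i2eL).
have i12 : integrable (fun t =>
    (beta0 ^+ 2 + eps t ^+ 2) + (2 * beta0 * L t + L t ^+ 2)).
  exact: (integrableD _ i1 i2).
have iu : integrable u by exact: (integrableD _ i12 i3).
rewrite (@cond_exp_ae _ _ _ P0 _ mGk _ u); last first.
- by apply: filterS model => t ->; rewrite -/(L t) /u; ring.
- by apply/measurable_EFinP; exact: (measurable_int _ iu).
- exact: measurable_funX.
rewrite (cond_expD mGk i12 i3) (cond_expD mGk i1 i2) (cond_expD mGk ic ieps2).
rewrite (cond_expD mGk i2L iL2) (cond_expD mGk i2e i2eL).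
rewrite (cond_expZ mGk _ iL) (cond_expZ mGk _ ieps) (cond_expZ mGk _ ieL).
rewrite (cond_exp_cst mGk _ (G_pos k)) Eeps Eeps2 EepsL ELE EL2E.
ring.
Qed.

End Population.

(** * Sample means within one group *)

Section SampleMeans.
Context {R : realType} {d0 d1 d' : measure_display} {T0 : measurableType d0}
  {T : measurableType d1} {T' : measurableType d'}.
Variables (P0 : probability T0 R) (P : probability T R).
Variables (Z : {RV P0 >-> T'}) (K : nat) (G : T0 -> 'I_K) (k : 'I_K).
Hypothesis mGk : measurable (G @^-1` [set k]).
Hypothesis Gk_pos : (0 < P0 (G @^-1` [set k]))%E.

Lemma cond_iid_sample_law n (S : 'I_n -> {RV P >-> T'}) i (B : set T') :
  cond_iid_sample P0 P Z G k (fun i => S i : T -> T') -> measurable B ->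
  P (S i @^-1` B) = distribution (cond_measure P0 mGk) Z B.
Proof.
move=> [law _] mB; rewrite /distribution /pushforward cond_measureE//.
  rewrite -(law i)// fineK// fin_num_measure//; exact: measurable_funPTI.
exact: measurable_funPTI.
Qed.

Lemma cond_iid_sample_indep n (S : 'I_n -> {RV P >-> T'}) i j (A B : set T') :
  cond_iid_sample P0 P Z G k (fun i => S i : T -> T') ->
  i != j -> measurable A -> measurable B ->
  P (S i @^-1` A `&` S j @^-1` B) = (P (S i @^-1` A) * P (S j @^-1` B))%E.
Proof.
move=> [_ ind] ij mA mB.
(* Mutual independence is applied to the pair of indices [i] and [j] only, so the value of [E]
   elsewhere is immaterial. *)
pose E l := if l == i then S i @^-1` A else S j @^-1` B.
have Ei : E i = S i @^-1` A by rewrite /E eqxx.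
have Ej : E j = S j @^-1` B by rewrite /E eq_sym (negbTE ij).
have mSA : measurable (S i @^-1` A) by exact: measurable_funPTI.
have mSB : measurable (S j @^-1` B) by exact: measurable_funPTI.
have := ind [set i; j]%SET E.
rewrite big_setU1 ?inE//= big_set1 Ei Ej.
have -> : \bigcap_(l in [set` [set i; j]%SET]) E l = S i @^-1` A `&` S j @^-1` B.
  rewrite -Ei -Ej; apply/seteqP; split=> t.
    by move=> h; split; apply: h; rewrite /= !inE eqxx ?orbT.
  by move=> [Eit Ejt] l /=; rewrite !inE => /orP[] /eqP ->.
move=> h; rewrite -[LHS]fineK ?fin_num_measure//; last exact: measurableI.
rewrite h => [|l]; first by rewrite EFinM !fineK// fin_num_measure.
rewrite !inE => /orP[] /eqP ->; rewrite ?Ei ?Ej.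
  by exists A => //; rewrite setTI.
by exists B => //; rewrite setTI.
Qed.

Variables (n : nat -> nat) (S : forall m, 'I_(n m) -> {RV P >-> T'}).
Arguments S : clear implicits.
Hypothesis S_iid : forall m,
  cond_iid_sample P0 P Z G k (fun i => S m i : T -> T').
Hypothesis n_oo : n @ \oo --> \oo.

(** The observations have as common law [Q] the law of [Z] under the measure conditioned on the
    group, and the mean of [g] under [Q] is the conditional expectation. *)
Lemma sample_mean_pcvg (g : T' -> R) : measurable_fun [set: T'] g ->
  P0.-integrable [set: T0] (EFin \o (g \o Z)) ->
  pcvg P (fun m t => (n m)%:R^-1 * \sum_i g (S m i t))
    (cond_exp P0 (g \o Z) (G @^-1` [set k])).
Proof.
move=> mg ig; pose Q := distribution (cond_measure P0 mGk) Z.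
have igc := integrable_cond_measure mGk Gk_pos ig.
have igQ : Q.-integrable [set: T'] (EFin \o g).
  by apply: integrable_distribution => //; exact/measurable_EFinP.
have gQ : \int[Q]_y g y = cond_exp P0 (g \o Z) (G @^-1` [set k]).
  rewrite -(Rintegral_cond_measure mGk Gk_pos ig) /Rintegral; congr fine.
  by apply: integral_distribution => //; exact/measurable_EFinP.
rewrite -gQ; apply: weak_law => //.
- by move=> m i B mB; exact: cond_iid_sample_law.
- by move=> m i j A B ij mA mB; exact: (cond_iid_sample_indep (S_iid m)).
Qed.

End SampleMeans.

(** * Difference of the variances of two mixtures *)

Section Mixture.
Context {R : realType} {d : measure_display} {T : measurableType d}.
Variables (P : probability T R) (K : nat).

Lemma pcvg_near (Z Z' : nat -> T -> R) z :
  (forall m, measurable_fun [set: T] (Z' m)) ->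
  (\forall m \near \oo, forall t, Z m t = Z' m t) ->
  pcvg P Z z -> pcvg P Z' z.
Proof.
move=> mZ' ZZ' [mZ cZ]; split=> //; apply: cvg_trans cZ; apply: near_eq_cvg.
have near_fst : \forall q \near high_prob P, forall t, Z q.1 t = Z' q.1 t.
  exact: (cvg_fst_high_prob P ZZ').
by apply: filterS near_fst => q; exact.
Qed.

Lemma pcvg_sum0 (Z : 'I_K -> nat -> T -> R) : (forall k, pcvg P (Z k) 0) ->
  pcvg P (fun m t => \sum_k Z k m t) 0.
Proof. by move=> Z0; have := pcvg_sum (index_enum _) Z0; rewrite big1. Qed.

Lemma pcvg_weighted (p : nat -> 'I_K -> R) (Z : 'I_K -> nat -> T -> R)
  (z : 'I_K -> R) :
  (forall m k, `|p m k| <= 1) -> (forall k, pcvg P (Z k) (z k)) ->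
  pcvg P (fun m t => \sum_k p m k * (Z k m t - z k)) 0.
Proof.
move=> p1 Zz; apply: pcvg_sum0 => k; apply: (pcvg_bounded0 (M := 1)) => [m//|].
by rewrite -(subrr (z k)); apply: pcvgB => //; exact: pcvg_cst.
Qed.

Lemma weighted_bounded (p : nat -> 'I_K -> R) (v : 'I_K -> R) (C : R) m :
  (forall m k, `|p m k| <= C) -> `|\sum_k p m k * v k| <= \sum_k C * `|v k|.
Proof.
move=> p1; apply: le_trans (ler_norm_sum _ _ _) _; apply: ler_sum => k _.
by rewrite normrM ler_wpM2r.
Qed.

(** Here [a] and [y] are second and first group moments of the response, [c] and [u] those of the
    regression function without intercept. The weights may oscillate, so the statistic is compared
    with a deterministic sequence; in that sequence all but [s2] is governed by [p - q]. *)
Lemma pcvg_mixture_variance (p q : nat -> 'I_K -> R)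
  (a y c u : 'I_K -> nat -> T -> R) (b0 s2 : R) (v w : 'I_K -> R) :
  (forall m k, `|p m k| <= 1) -> (forall m k, `|q m k| <= 1) ->
  (\forall m \near \oo, \sum_k p m k = 1) ->
  (forall k, p m k - q m k @[m --> \oo] --> (0 : R)) ->
  (forall k, pcvg P (a k) (b0 ^+ 2 + s2 + 2 * b0 * v k + w k)) ->
  (forall k, pcvg P (y k) (b0 + v k)) ->
  (forall k, pcvg P (c k) (w k)) -> (forall k, pcvg P (u k) (v k)) ->
  pcvg P (fun m t => \sum_k p m k * a k m t - (\sum_k p m k * y k m t) ^+ 2
    - (\sum_k q m k * c k m t - (\sum_k q m k * u k m t) ^+ 2)) s2.
Proof.
move=> p1 q1 sump pq a_cvg y_cvg c_cvg u_cvg.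
(* [D] is the statistic with the moments replaced by their limits. *)
pose A k := b0 ^+ 2 + s2 + 2 * b0 * v k + w k.
pose B m := \sum_k p m k * (b0 + v k).
pose V m := \sum_k q m k * v k.
pose D m := \sum_k p m k * A k - B m ^+ 2 - (\sum_k q m k * w k - V m ^+ 2).
have dcvg (z : 'I_K -> R) : pcvg P (fun m _ => \sum_k (p m k - q m k) * z k) 0.
  apply: pcvg_sum0 => k; rewrite -(mul0r (z k)); apply: pcvgM.
    exact: pcvg_seq.
  exact: pcvg_cst.
have D_cvg : pcvg P (fun m _ => D m) s2.
  (* Once the [p m k] sum to 1, the intercept cancels from [D], and the difference of the two
     squared means factors through [p + q] and [p - q]. *)
  pose D' m := s2 + \sum_k (p m k - q m k) * w k
    - (\sum_k (p m k + q m k) * v k) * (\sum_k (p m k - q m k) * v k).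
  apply: (pcvg_near (Z := fun m _ => D' m)) => //.
    apply: filterS sump => m sump _; rewrite /D' /D.
    have -> : \sum_k p m k * A k = b0 ^+ 2 + s2 + 2 * b0 * (\sum_k p m k * v k)
        + \sum_k p m k * w k.
      rewrite -[X in X + _ + _](mulr1 (b0 ^+ 2 + s2)) -[X in _ * X + _ + _]sump.
      rewrite !mulr_sumr -!big_split /=.
      by apply: eq_bigr => k _; rewrite /A; ring.
    have -> : B m = b0 + \sum_k p m k * v k.
      rewrite -[in RHS](mulr1 b0) -sump mulr_sumr -big_split /=.
      by apply: eq_bigr => k _; ring.
    have E1 z : \sum_k (p m k - q m k) * z k =
        \sum_k p m k * z k - \sum_k q m k * z k.
      by rewrite -sumrB; apply: eq_bigr => k _; ring.
    have E2 : \sum_k (p m k + q m k) * v k =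
        \sum_k p m k * v k + \sum_k q m k * v k.
      by rewrite -big_split; apply: eq_bigr => k _ /=; ring.
    rewrite !E1 E2 /V; ring.
  rewrite [X in pcvg _ _ X](_ : s2 = s2 + 0 - 0); last by rewrite addr0 subr0.
  apply: pcvgB; first by apply: pcvgD; [exact: pcvg_cst|exact: dcvg].
  apply: (pcvg_bounded0 (M := \sum_k 2 * `|v k|)) => [m|]; last exact: dcvg.
  apply: (weighted_bounded (p := fun m k => p m k + q m k)) => m' k.
  by apply: le_trans (ler_normD _ _) _; rewrite (_ : 2 = 1 + 1)// lerD.
pose s m t := \sum_k p m k * (y k m t - (b0 + v k)).
pose r m t := \sum_k q m k * (u k m t - v k).
have s_cvg : pcvg P s 0 by exact: pcvg_weighted.
have r_cvg : pcvg P r 0 by exact: pcvg_weighted.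
have Bs_cvg : pcvg P (fun m t => B m * s m t) 0.
  by apply: pcvg_bounded0 s_cvg => m; exact: weighted_bounded.
have Vr_cvg : pcvg P (fun m t => V m * r m t) 0.
  by apply: pcvg_bounded0 r_cvg => m; exact: weighted_bounded.
have sq_cvg (f : nat -> T -> R) : pcvg P f 0 ->
    pcvg P (fun m t => f m t * f m t) 0.
  by move=> f0; rewrite -(mulr0 0); exact: pcvgM.
(* The exact difference between the statistic and [D]: the squared means are [(B m + s m t) ^+ 2]
   and [(V m + r m t) ^+ 2], and only the cross terms and the squares of [s] and [r] survive. *)
have lim0 := pcvgD
  (pcvgB (pcvg_weighted p1 a_cvg)
    (pcvgD (sq_cvg _ s_cvg) (pcvgM (pcvg_cst P 2) Bs_cvg)))
  (pcvgB (pcvgD (sq_cvg _ r_cvg) (pcvgM (pcvg_cst P 2) Vr_cvg))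
    (pcvg_weighted q1 c_cvg)).
have := pcvgD D_cvg lim0; apply: eq_pcvg => [m t|]; last by ring.
have E (e : nat -> 'I_K -> R) (Z : 'I_K -> nat -> T -> R) (z : 'I_K -> R) :
    \sum_k e m k * (Z k m t - z k) = \sum_k e m k * Z k m t - \sum_k e m k * z k.
  by rewrite -sumrB; apply: eq_bigr => k _; rewrite mulrBr.
rewrite /s /r !E /D -/(A _) -/(B m) -/(V m); ring.
Qed.

End Mixture.

(** * Group sizes and group weights *)

Lemma nmin_le (K : nat) (ny nx : 'I_K -> nat) k :
  (nmin ny nx <= ny k)%N /\ (nmin ny nx <= nx k)%N.
Proof.
suff : (nmin ny nx <= minn (ny k) (nx k))%N by rewrite leq_min => /andP.
rewrite /nmin; have : k \in index_enum 'I_K by exact: mem_index_enum.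
elim: (index_enum _) => // l s IHs; rewrite inE big_cons => /predU1P[->|/IHs h].
  exact: geq_minl.
by rewrite (leq_trans _ h)// geq_minr.
Qed.

Lemma weight_le1 (R : realFieldType) (K : nat) (n : 'I_K -> nat) k :
  `|(n k)%:R / (total n)%:R : R| <= 1.
Proof.
rewrite ger0_norm ?divr_ge0 ?ler0n//.
(* If all samples are empty, division by 0 makes the weight 0. *)
have [->|n0] := eqVneq (total n) 0%N; first by rewrite invr0 mulr0 ler01.
rewrite ler_pdivrMr ?ltr0n ?lt0n// mul1r ler_nat /total (bigD1 k)//=.
exact: leq_addr.
Qed.

Lemma weight_sum (R : realFieldType) (K : nat) (n : 'I_K -> nat) :
  (0 < total n)%N -> \sum_k (n k)%:R / (total n)%:R = 1 :> R.
Proof.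
by move=> n0; rewrite -mulr_suml -natr_sum divff// pnatr_eq0 -lt0n.
Qed.

(** * Pooled moments as mixtures of group moments *)

Section EstimatorFormulas.
Context {R : realType} {K d : nat} {ny nx : 'I_K -> nat}.
Variables (y : forall k, 'I_(ny k) -> R) (x : forall k, 'I_(nx k) -> 'cV[R]_d).
Arguments y : clear implicits.
Arguments x : clear implicits.

(** The factor [n] cancels; for an empty sample both sides are 0. *)
Lemma weight_mean (n N : nat) (f : 'I_n -> R) :
  n%:R / N%:R * (n%:R^-1 * \sum_i f i) = N%:R^-1 * \sum_i f i.
Proof.
have [n0|n0] := posnP n.
  by subst n; rewrite !big_ord0 !mulr0.
by rewrite mulrA [n%:R / _]mulrC mulfK// pnatr_eq0 -lt0n.
Qed.

Lemma sigma2Y_hatE : sigma2Y_hat y =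
  \sum_k (ny k)%:R / (total ny)%:R * ((ny k)%:R^-1 * \sum_i y k i ^+ 2)
  - (\sum_k (ny k)%:R / (total ny)%:R * ((ny k)%:R^-1 * \sum_i y k i)) ^+ 2.
Proof.
rewrite /sigma2Y_hat mulr_sumr /muY_tot mulr_sumr; congr (_ - _ ^+ 2).
  by apply: eq_bigr => k _; rewrite weight_mean.
by apply: eq_bigr => k _; rewrite mxE mulrCA mulrA.
Qed.

Lemma muX_hatE k j : muX_hat x k j 0 = (nx k)%:R^-1 * \sum_i x k i j 0.
Proof. by rewrite /muX_hat mxE summxE. Qed.

(** The quadratic form is the pooled empirical variance of the linear combination with coefficients
    [b]. Second moments are kept entry by entry, so that random coefficients and sample moments can
    converge separately. *)
Lemma quad_GammaX_hat (b : 'cV[R]_d) : (b^T *m GammaX_hat x *m b) 0 0 =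
  \sum_k (nx k)%:R / (total nx)%:R * (\sum_i \sum_j b i 0 * b j 0 *
     ((nx k)%:R^-1 * \sum_l x k l i 0 * x k l j 0))
  - (\sum_k (nx k)%:R / (total nx)%:R * (\sum_j b j 0 * muX_hat x k j 0)) ^+ 2.
Proof.
have quad (v : 'cV[R]_d) :
    (b^T *m (v *m v^T) *m b) 0 0 = (\sum_j b j 0 * v j 0) ^+ 2.
  rewrite mulmxA -mulmxA [LHS]mxE big_ord1 expr2; congr (_ * _).
    by rewrite mxE; apply: eq_bigr => j _; rewrite !mxE.
  by rewrite mxE; apply: eq_bigr => j _; rewrite !mxE mulrC.
rewrite /GammaX_hat mulmxBr mulmxBl [LHS]mxE [X in _ + X]mxE quad.
congr (_ - _ ^+ 2).
  rewrite -scalemxAr -scalemxAl mxE mulmx_sumr mulmx_suml summxE mulr_sumr.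
  apply: eq_bigr => k _; rewrite mulmx_sumr mulmx_suml summxE.
  rewrite -weight_mean; congr (_ * _).
  rewrite mulr_sumr; under eq_bigr do rewrite quad.
  under [RHS]eq_bigr => i _.
    under eq_bigr => j _ do rewrite mulrCA mulr_sumr mulr_sumr.
    rewrite exchange_big /=; over.
  rewrite exchange_big /=; apply: eq_bigr => l _.
  rewrite expr2 mulr_suml mulr_sumr; apply: eq_bigr => i _.
  rewrite !mulr_sumr; apply: eq_bigr => j _; ring.
rewrite /muX_tot; under eq_bigr => j _.
  rewrite mxE summxE mulrCA mulr_sumr mulr_sumr; over.
rewrite exchange_big /=; apply: eq_bigr => k _; rewrite mulr_sumr.
by apply: eq_bigr => j _; rewrite mxE; ring.
Qed.

End EstimatorFormulas.

(** * Convergence of the weighted least-squares estimator *)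

Section Design.
Context {R : realType} {d1 : measure_display} {T : measurableType d1}.
Variables (P : probability T R) (K d : nat).

Lemma mx_pcvg_design (mu : nat -> T -> 'I_K -> 'cV[R]_d)
  (mu0 : 'I_K -> 'cV[R]_d) :
  (forall k j, pcvg P (fun m t => mu m t k j 0) (mu0 k j 0)) ->
  mx_pcvg P (fun m t => design (mu m t)) (design mu0).
Proof.
move=> mu_cvg k j; rewrite /design -[j]splitK; case: (fintype.split j) => l /=.
  apply: eq_pcvg (pcvg_cst P 1) => [m t|]; by rewrite row_mxEl mxE.
by apply: eq_pcvg (mu_cvg k l) => [m t|]; rewrite row_mxEr mxE.
Qed.

Lemma near_det_neq0 n (A : nat -> T -> 'M[R]_n) (A0 : 'M[R]_n) : mx_pcvg P A A0 ->
  \det A0 != 0 -> \forall q \near high_prob P, \det (A q.1 q.2) != 0.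
Proof. by move=> /pcvg_det_mx[_ cA]; exact: cvgr_neq0. Qed.

Variable w : 'I_K -> R.
Hypothesis w_pos : forall k, 0 < w k.
Variables (ny nx : nat -> 'I_K -> nat).
Variables (y : forall m (t : T) k, 'I_(ny m k) -> R)
  (x : forall m (t : T) k, 'I_(nx m k) -> 'cV[R]_d).
Variables (b : nat -> T -> 'cV[R]_(1 + d)) (s : nat -> T -> R).
Arguments y : clear implicits.
Arguments x : clear implicits.
Hypothesis mb : forall m i, measurable_fun [set: T] (fun t => b m t i 0).
Hypothesis ms : forall m, measurable_fun [set: T] (s m).
Variables (mu0 : 'I_K -> 'cV[R]_d) (beta : 'cV[R]_(1 + d)).
Hypothesis rank_mu : \rank (design mu0) = d.+1.
Hypothesis muX_cvg :
  forall k j, pcvg P (fun m t => muX_hat (x m t) k j 0) (mu0 k j 0).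
Hypothesis muY_cvg :
  forall k, pcvg P (fun m t => muY_hat (y m t) k 0) ((design mu0 *m beta) k 0).

Let W := diag_mx (\row_k w k).
Let D m t := design (muX_hat (x m t)).
Let A m t := (D m t)^T *m W *m D m t.
Let A0 := (design mu0)^T *m W *m design mu0.

Let D_cvg : mx_pcvg P D (design mu0).
Proof. exact: mx_pcvg_design. Qed.

Let A_cvg : mx_pcvg P A A0.
Proof.
apply: mx_pcvgM => //; apply: mx_pcvgM; last exact: mx_pcvg_cst.
exact: mx_pcvg_tr.
Qed.

Let full_rank m t : (\rank (D m t) == d.+1) = (\det (A m t) != 0).
Proof. exact: (rank_wgram (D m t) w_pos). Qed.

Let A0_neq0 : \det A0 != 0.
Proof. by rewrite -(rank_wgram _ w_pos) rank_mu. Qed.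

(** The limiting Gram matrix is invertible by the rank hypothesis, and a nonzero determinant is an
    open condition. *)
Lemma full_rank_near : \forall q \near high_prob P, \rank (D q.1 q.2) == d.+1.
Proof.
by apply: filterS (near_det_neq0 A_cvg A0_neq0) => q; rewrite full_rank.
Qed.

Lemma measurable_full_rank m :
  measurable_fun [set: T] (fun t => \rank (D m t) == d.+1).
Proof.
under eq_fun do rewrite full_rank.
apply: measurable_neg; apply: measurable_fun_eqr => //.
exact: (pcvg_det_mx A_cvg).1.
Qed.

(** Cramer's form of the estimator, equal to it at full rank and given elsewhere by the same
    formula, with the inverse of 0 read as 0. *)
Let beta_adj m t :=
  (\det (A m t))^-1 *: (\adj (A m t) *m (D m t)^T *m W *m muY_hat (y m t)).

Let invmxE (M : 'M[R]_(1 + d)) : \det M != 0 -> invmx M = (\det M)^-1 *: \adj M.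
Proof. by move=> M0; rewrite /invmx unitmxE unitfE M0. Qed.

Let beta_adj_cvg : mx_pcvg P beta_adj beta.
Proof.
(* The population moments solve the normal equations exactly: the product of [\adj A0] and [A0] is
   the scalar [\det A0], which leaves [beta]. *)
have -> : beta = (\det A0)^-1 *:
    (\adj A0 *m (design mu0)^T *m W *m (design mu0 *m beta)).
  rewrite !mulmxA -!mulmxA !(mulmxA _ _ (_ *m beta)) !mulmxA.
  rewrite -(mulmxA _ _ (design mu0)) -(mulmxA (\adj A0)) (mulmxA _ W) -/A0.
  by rewrite mul_adj_mx mul_scalar_mx scalerA mulVf// scale1r.
move=> i j.
pose M m t := \adj (A m t) *m (D m t)^T *m W *m muY_hat (y m t).
pose M0 := \adj A0 *m (design mu0)^T *m W *m (design mu0 *m beta).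
have M_cvg : mx_pcvg P M M0.
  apply: mx_pcvgM; last by move=> k l; rewrite ord1; exact: muY_cvg.
  apply: mx_pcvgM; last exact: mx_pcvg_cst.
  apply: mx_pcvgM; [exact: mx_pcvg_adj|exact: mx_pcvg_tr].
apply: eq_pcvg (pcvgM (pcvgV A0_neq0 (pcvg_det_mx A_cvg)) (M_cvg i j)) => [m t|];
  by rewrite [RHS]mxE.
Qed.

Lemma beta_M_pcvg i :
  pcvg P (fun m t => beta_M w (y m t) (x m t) (b m t) i 0) (beta i 0).
Proof.
have := pcvg_if measurable_full_rank full_rank_near (fun m => mb m i)
  (beta_adj_cvg i 0).
apply: eq_pcvg => // m t; rewrite /beta_M -/(D m t); case: ifP => //.
rewrite full_rank => /invmxE Ai; rewrite -/W -/(A m t) Ai.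
by rewrite /beta_adj -!scalemxAl.
Qed.

Variable sigma2 : R.
Hypothesis sigma2_cvg : pcvg P (fun m t =>
  let b0 := dsubmx (beta_M w (y m t) (x m t) (b m t)) in
  sigma2Y_hat (y m t) - (b0^T *m GammaX_hat (x m t) *m b0) 0 0) sigma2.

Lemma sigma2_M_pcvg :
  pcvg P (fun m t => sigma2_M w (y m t) (x m t) (b m t) (s m t)) sigma2.
Proof.
exact: (pcvg_if measurable_full_rank full_rank_near ms sigma2_cvg).
Qed.

End Design.

(** * Consistency of the estimators of the coefficients and of the noise variance *)

Theorem lemma4p1 (R : realType) (K d : nat)
  (* population: Y = beta_0 + sum_j beta_j X_j + eps *)
  (d0 : measure_display) (T0 : measurableType d0) (P0 : probability T0 R)
  (Y eps : {RV P0 >-> R}) (X : {RV P0 >-> d.-tuple R}) (G : T0 -> 'I_K)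
  (beta : 'cV[R]_(1 + d)) (sigma2 : R)
  (mG : sigma_discrete G `<=` measurable)
  (G_pos : forall k, (0 < P0 (G @^-1` [set k]))%E)
  (model : {ae P0, forall t, Y t =
     usubmx beta 0 0 + \sum_(j < d) dsubmx beta j 0 * tnth (X t) j + eps t})
  (eps_indep : independent2 P0 (sigma_of eps)
     <<s sigma_of X `|` sigma_discrete G >>)
  (eps_mean : ('E_P0[eps] = 0)%E)
  (eps_var : ('V_P0[eps] = sigma2%:E)%E)
  (* weights *)
  (w : 'I_K -> R) (w_pos : forall k, 0 < w k) (w_sum : \sum_k w k = 1)
  (* data: along the sequence, the m-th samples have sizes ny m k and nx m k *)
  (d1 : measure_display) (T : measurableType d1) (P : probability T R)
  (ny nx : nat -> 'I_K -> nat)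
  (Ys : forall m (k : 'I_K), 'I_(ny m k) -> {RV P >-> R})
  (Xs : forall m (k : 'I_K), 'I_(nx m k) -> {RV P >-> d.-tuple R})
  (Ys_iid : forall m k, cond_iid_sample P0 P Y G k (fun i => Ys m k i))
  (Xs_iid : forall m k, cond_iid_sample P0 P X G k (fun i => Xs m k i))
  (YXs_indep : forall m, mutually_independent P
     (fun s : 'I_K + 'I_K => match s with
      | inl k => sigma_join (fun i => sigma_of (Ys m k i))
      | inr k => sigma_join (fun i => sigma_of (Xs m k i))
      end))
  (* arbitrary values of the estimators in the rank-deficient case *)
  (b : nat -> {RV P >-> (1 + d).-tuple R}) (s : nat -> {RV P >-> R})
  (* hypotheses of the lemma *)
  (Y_L2 : ('E_P0[(fun t => Y t ^+ 2)%R] < +oo)%E)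
  (X_L2 : ('E_P0[(fun t => enorm (col_of_tuple (X t)) ^+ 2)%R] < +oo)%E)
  (rank_mu : \rank (design (fun k => \col_(j < d)
     cond_exp P0 (fun t => tnth (X t) j) (G @^-1` [set k]))) = d.+1)
  (nmin_oo : nmin (ny m) (nx m) @[m --> \oo] --> \oo) :
  let y m t k i := Ys m k i t in
  let x m t k i := col_of_tuple (Xs m k i t) in
  let beta_hat m t := beta_M w (y m t) (x m t) (col_of_tuple (b m t)) in
  let sigma2_hat m t :=
    sigma2_M w (y m t) (x m t) (col_of_tuple (b m t)) (s m t) in
  (* The variance estimator compares a variance of Y taken over the mixture with
     weights ny m k / N_y to one of X over the mixture with weights
     nx m k / N_x: its limit is sigma2 only if these weights match in the limit. *)
  cvg_in_probability P beta_hat beta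
  /\ ((forall k, (ny m k)%:R / (total (ny m))%:R
                 - (nx m k)%:R / (total (nx m))%:R @[m --> \oo] --> (0 : R)) ->
      cvg_in_probability P
        (fun m t => col_mx (beta_hat m t) (sigma2_hat m t)%:M)
        (col_mx beta sigma2%:M)).
Proof.
move=> y x beta_hat sigma2_hat.
pose E k (f : T0 -> R) := cond_exp P0 f (G @^-1` [set k]).
pose mu0 (k : 'I_K) : 'cV[R]_d := \col_(j < d) E k (fun t => tnth (X t) j).
pose b0 := usubmx beta 0 0; pose bt j := dsubmx beta j 0.
have mGk k : measurable (G @^-1` [set k]) by exact: measurable_group.
have n_oo (n : nat -> 'I_K -> nat) :
    (forall m k, nmin (ny m) (nx m) <= n m k)%N ->
    forall k, n m k @[m --> \oo] --> \oo.
  move=> nn k F [N _ NF].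
  have nmin_N : \forall m \near \oo, (N <= nmin (ny m) (nx m))%N :=
    nmin_oo _ (nbhs_infty_ge N).
  by apply: filterS nmin_N => m Nm; apply: NF => /=; exact: leq_trans (nn m k).
have ny_oo := n_oo ny (fun m k => (nmin_le (ny m) (nx m) k).1).
have nx_oo := n_oo nx (fun m k => (nmin_le (ny m) (nx m) k).2).
have Y_mean k (g : R -> R) : measurable_fun [set: R] g ->
    P0.-integrable [set: T0] (EFin \o (g \o Y)) ->
    pcvg P (fun m t => (ny m k)%:R^-1 * \sum_i g (Ys m k i t)) (E k (g \o Y)).
  by apply: (sample_mean_pcvg (mGk k) (G_pos k) (S := fun m => Ys m k)).
have X_mean k (g : d.-tuple R -> R) : measurable_fun [set: d.-tuple R] g ->
    P0.-integrable [set: T0] (EFin \o (g \o X)) ->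
    pcvg P (fun m t => (nx m k)%:R^-1 * \sum_i g (Xs m k i t)) (E k (g \o X)).
  by apply: (sample_mean_pcvg (mGk k) (G_pos k) (S := fun m => Xs m k)).
have EY k : E k Y = b0 + \sum_j bt j * E k (fun t => tnth (X t) j).
  exact: (cond_exp_Y mG G_pos model eps_indep eps_mean Y_L2 X_L2).
have EY2 k := cond_exp_Y2 mG G_pos model eps_indep eps_mean eps_var Y_L2 X_L2 k.
have muX_cvg k j : pcvg P (fun m t => muX_hat (x m t) k j 0) (mu0 k j 0).
  have := X_mean k (fun z => tnth z j) (measurable_tnth j)
    (integrable_coord X_L2 j).
  apply: eq_pcvg => [m t|]; last by rewrite mxE.
  by rewrite muX_hatE; congr (_ * _); apply: eq_bigr => i _; rewrite mxE.
have muY_cvg k : pcvg P (fun m t => muY_hat (y m t) k 0) (E k Y).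
  have := Y_mean k id (@measurable_id _ _ _) (integrable_Y Y_L2).
  by apply: eq_pcvg => // m t; rewrite mxE.
(* The column of ones in the design carries the intercept, the other columns the slopes. *)
have design_beta k : (design mu0 *m beta) k 0 = E k Y.
  rewrite EY -[beta in LHS]vsubmxK mul_row_col mxE; congr (_ + _).
    by rewrite mxE big_ord1 mxE mul1r.
  rewrite mxE; apply: eq_bigr => j _; rewrite mulrC; congr (_ * _).
  by rewrite !mxE.
have mb m i : measurable_fun [set: T] (fun t => col_of_tuple (b m t) i 0).
  under eq_fun do rewrite mxE.
  exact: (measurableT_comp (measurable_tnth i)).
have muY_cvg' k :
    pcvg P (fun m t => muY_hat (y m t) k 0) ((design mu0 *m beta) k 0).
  by rewrite design_beta.
have beta_cvg i : pcvg P (fun m t => beta_hat m t i 0) (beta i 0).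
  exact: (beta_M_pcvg w_pos mb rank_mu muX_cvg muY_cvg').
split; first exact: pcvg_in_probability.
move=> weights; apply: pcvg_in_probability => i.
have sigma2_cvg : pcvg P sigma2_hat sigma2.
  have ms m : measurable_fun [set: T] (s m) by [].
  apply: (sigma2_M_pcvg w_pos ms rank_mu muX_cvg).
  have bt_cvg j : pcvg P (fun m t => dsubmx (beta_hat m t) j 0) (bt j).
    apply: eq_pcvg (beta_cvg (rshift 1 j)) => [m t|]; by rewrite [RHS]mxE.
  pose p (n : nat -> 'I_K -> nat) m k : R := (n m k)%:R / (total (n m))%:R.
  have sum_p : \forall m \near \oo, \sum_k p ny m k = 1.
    (* With no group at all the weights [w] would sum to 0 instead of 1. The first group then makes
       the total size eventually positive. *)
    have K_gt0 : (0 < K)%N.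
      rewrite lt0n; apply/eqP => K0; move: w_sum; rewrite big1.
        by move/eqP; rewrite eq_sym oner_eq0.
      by move=> k _; move: (ltn_ord k); rewrite [X in (_ < X)%N]K0.
    pose k0 := Ordinal K_gt0.
    have ny_gt0 : \forall m \near \oo, (1 <= ny m k0)%N :=
      ny_oo k0 _ (nbhs_infty_ge 1).
    apply: filterS ny_gt0 => m m1.
    apply: weight_sum; apply: leq_trans m1 _.
    by rewrite /total (bigD1 k0)//= leq_addr.
  pose y2 k m t := (ny m k)%:R^-1 * \sum_i Ys m k i t ^+ 2.
  (* Group moments of the fitted regression function without intercept: [xx] and [u] carry the
     estimated slopes, and their limits [ww] and [v] the true ones. *)
  pose xx k m t := \sum_i \sum_j
    dsubmx (beta_hat m t) i 0 * dsubmx (beta_hat m t) j 0 *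
    ((nx m k)%:R^-1 * \sum_l x m t k l i 0 * x m t k l j 0).
  pose u k m t := \sum_j dsubmx (beta_hat m t) j 0 * muX_hat (x m t) k j 0.
  pose v k := \sum_j bt j * mu0 k j 0.
  pose ww k :=
    \sum_i \sum_j bt i * bt j * E k (fun t => tnth (X t) i * tnth (X t) j).
  have vE k : v k = \sum_j bt j * E k (fun t => tnth (X t) j).
    by apply: eq_bigr => j _; rewrite mxE.
  have y2_cvg k : pcvg P (y2 k) (b0 ^+ 2 + sigma2 + 2 * b0 * v k + ww k).
    rewrite vE -EY2; have := Y_mean k (fun z => z ^+ 2) _ (integrable_Y2 Y_L2).
    by apply; exact: measurable_funX.
  have yk_cvg k :
      pcvg P (fun m t => (ny m k)%:R^-1 * \sum_i Ys m k i t) (b0 + v k).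
    rewrite vE -EY.
    exact: (Y_mean k id (@measurable_id _ _ _) (integrable_Y Y_L2)).
  have xx_cvg k : pcvg P (xx k) (ww k).
    apply: pcvg_sum => i'; apply: pcvg_sum => j; apply: pcvgM; first exact: pcvgM.
    have mij : measurable_fun [set: d.-tuple R] (fun z => tnth z i' * tnth z j).
      by apply: measurable_funM; exact: measurable_tnth.
    apply: eq_pcvg (X_mean k _ mij (integrable_coordM X_L2 i' j)) => // m t.
    by congr (_ * _); apply: eq_bigr => l _; rewrite !mxE.
  have u_cvg k : pcvg P (u k) (v k).
    by apply: pcvg_sum => j; exact: pcvgM.
  have := pcvg_mixture_variance (p := p ny) (q := p nx)
    (fun m => weight_le1 R (ny m)) (fun m => weight_le1 R (nx m)) sum_p weights
    y2_cvg yk_cvg xx_cvg u_cvg.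
  apply: eq_pcvg => // m t.
  by rewrite /= sigma2Y_hatE quad_GammaX_hat.
rewrite -[i]splitK; case: (fintype.split i) => l /=.
  by apply: eq_pcvg (beta_cvg l) => [m t|]; rewrite col_mxEu.
by apply: eq_pcvg sigma2_cvg => [m t|]; rewrite col_mxEd mxE ord1 eqxx.
Qed.
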